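(* Let $\kappa>0$, $h\in(0,1]$, $b\in(-\infty,0)$, and let $\xi=(\xi(x))_{x\in\mathbb{Z}}$ be non-constant i.i.d. with law $\mathrm{Prob}=\eta^{\mathbb{Z}}$, where $\eta$ is a probability measure on $[b,0]$, and $\operatorname{ess\,sup}\xi(0)=0$. Then for all $p>0$ large enough, the solution $u$ of the parabolic Anderson model $\partial_t u=\kappa\Delta_h u+\xi u$, $u(0,\cdot)\equiv1$, is $p$-intermittent, i.e. $\lambda_{p+\varepsilon}>\lambda_p$ for all sufficiently small $\varepsilon>0$.
   Context: Expectation with respect to $\mathrm{Prob}$ is denoted $\langle\cdot\rangle$. Let $\Delta_h f(x)=\frac{1+h}{2}(f(x+1)-f(x))+\frac{1-h}{2}(f(x-1)-f(x))$ for $f:\mathbb{Z}\to\mathbb{R}$. For fixed $\xi$, $u:\mathbb{R}_+\times\mathbb{Z}\to\mathbb{R}$ is the unique bounded non-negative solution of $\partial_t u(t,x)=\kappa\Delta_h u(t,x)+\xi(x)u(t,x)$, $u(0,\cdot)\equiv1$; in particular $u(t,0)=\mathbb{E}_0\exp\{\int_0^t\xi(X_s)\,ds\}$, where $X$ is the continuous-time random walk on $\mathbb{Z}$ started at $0$ with generator $\kappa\Delta_h$, independent of $\xi$. For $p\in(0,\infty)$, the $p$-th annealed Lyapunov exponent is $\lambda_p=\lim_{t\to\infty}\frac1t\log\langle u(t,0)^p\rangle^{1/p}$; under the present assumptions this limit exists for all $p\in(0,\infty)$. *)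

(* Defs.v *)
From HB Require Import structures.
From mathcomp Require Import all_boot all_order all_algebra.
From mathcomp Require Import all_classical all_reals all_analysis.
Set Implicit Arguments.
Unset Strict Implicit.
Unset Printing Implicit Defensive.
Import Order.TTheory GRing.Theory Num.Theory.
Import numFieldNormedType.Exports.
Local Open Scope classical_set_scope.
Local Open Scope ring_scope.

Section Environment.
Context {d : measure_display} {T : measurableType d} {R : realType}.
Variable P : probability T R.

(* Mutual independence: the product rule on every finite set of sites. *)
Definition mutually_independent (X : int -> {RV P >-> R}) : Prop :=
  forall (s : seq int) (A : int -> set R), uniq s ->
    (forall x, measurable (A x)) ->
    P (\bigcap_(x in [set` s]) (X x @^-1` A x)) =
    (\prod_(x <- s) P (X x @^-1` A x))%E.

(* The field X has law eta^Z. *)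
Definition iid_with_law (eta : probability (measurableTypeR R) R)
    (X : int -> {RV P >-> R}) : Prop :=
  mutually_independent X /\
  (forall x (A : set R), measurable A -> distribution P (X x) A = eta A).

Definition as_constant (X : int -> {RV P >-> R}) : Prop :=
  exists c : R, \forall w \ae P, forall x, X x w = c.

End Environment.

Section ParabolicAndersonModel.
Context {R : realType}.

Definition drift_laplacian (h : R) (f : int -> R) (x : int) : R :=
  (1 + h) / 2 * (f (x + 1) - f x) + (1 - h) / 2 * (f (x - 1) - f x).

(* Bounded non-negative solution on [0, +oo[ x Z for a fixed environment xi.
   Only the values u t x with 0 <= t matter; the equation is imposed for t > 0,
   together with continuity up to the initial time. *)
Record pam_solution (kappa h : R) (xi : int -> R) (u : R -> int -> R) : Prop :=
  PamSolution {
    pam_init : forall x, u 0 x = 1;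
    pam_cont : forall x, {within `[0, +oo[, continuous (u ^~ x)};
    pam_eq : forall (t : R) (x : int), 0 < t ->
      is_derive t 1 (u ^~ x)
        (kappa * drift_laplacian h (u t) x + xi x * u t x);
    pam_ge0 : forall (t : R) (x : int), 0 <= t -> 0 <= u t x;
    pam_bounded : exists M : R, forall (t : R) (x : int), 0 <= t -> u t x <= M
  }.

End ParabolicAndersonModel.

Section Lyapunov.
Context {d : measure_display} {T : measurableType d} {R : realType}.
Variable P : probability T R.

Definition lyapunov (u : T -> R -> int -> R) (p : R) : R :=
  lim (t^-1 * ln (fine 'E_P[fun w => u w t 0 `^ p] `^ p^-1) @[t --> +oo_R]).

Definition intermittent (u : T -> R -> int -> R) (p : R) : Prop :=
  \forall e \near 0^'+, lyapunov u p < lyapunov u (p + e).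

End Lyapunov.

(* Main.v *)
Require Import Defs.
From HB Require Import structures.
From mathcomp Require Import all_boot all_order all_algebra.
From mathcomp Require Import all_classical all_reals all_analysis ess_sup_inf measurable_realfun.
From mathcomp Require Import ring lra zify.
Set Implicit Arguments.
Unset Strict Implicit.
Unset Printing Implicit Defensive.
Import Order.TTheory GRing.Theory Num.Theory.
Import numFieldNormedType.Exports.
Local Open Scope classical_set_scope.
Local Open Scope ring_scope.

(** With c = kappa - b, the operator A = kappa Delta_h + xi + c has nonnegative
    entries and u(t, 0) = e^(- c t) sum_n t^n / n! a_n(0), where a_n = A^n 1
    depends on finitely many sites.  Hence lambda_p = rho_p - c, where rho_p is the
    exponential growth rate in n of the L^p norm of a_n(0).  This rate exists: since
    a_(n+m)(0) >= (A^n delta_z)(0) a_m(z) and both factors are nondecreasing in xi,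
    Harris' inequality and shift invariance make the moments of a_n(0)
    supermultiplicative up to a polynomial factor.  Because of the drift the walk
    keeps discovering fresh sites, so rho_1 <= theta for some theta < c; on the
    other hand rho_p tends to c as p grows, since making xi nearly 0 on [-n, n] has a cost
    exponential in n that does not depend on p.  So rho_p > theta for large p, and
    x^p <= x + x^(p+e), applied to a_n(0) normalized at a level slightly above
    rho_p, forces rho_(p+e) > rho_p. *)

Section BoundedMeasurable.
Context {d : measure_display} {T : measurableType d} {R : realType}.
Variable Q : probability T R.
Implicit Types f g : T -> R.

Definition bmeas f := measurable_fun setT f /\ exists M, forall x, `|f x| <= M.

Definition mean f : R := \int[Q]_x f x.

Lemma bmeas_integrable f : bmeas f -> Q.-integrable setT (EFin \o f).
Proof.
move=> [mf [M fM]]; apply: measurable_bounded_integrable => //.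
  by rewrite -ge0_fin_numE// fin_num_measure.
exists M; split; first exact: num_real.
by move=> y My x _ /=; exact: le_trans (fM x) (ltW My).
Qed.

Lemma bmeas_cst (k : R) : bmeas (fun=> k).
Proof. by split; [exact: measurable_cst|exists `|k|]. Qed.

Lemma bmeasD f g : bmeas f -> bmeas g -> bmeas (fun x => f x + g x).
Proof.
move=> [mf [M fM]] [mg [N gN]]; split; first exact: measurable_funD.
by exists (M + N) => x; rewrite (le_trans (ler_normD _ _))// lerD.
Qed.

Lemma bmeasM f g : bmeas f -> bmeas g -> bmeas (fun x => f x * g x).
Proof.
move=> [mf [M fM]] [mg [N gN]]; split; first exact: measurable_funM.
by exists (M * N) => x; rewrite normrM ler_pM.
Qed.

Lemma bmeasZ k f : bmeas f -> bmeas (fun x => k * f x).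
Proof. by move=> ?; apply: bmeasM => //; exact: bmeas_cst. Qed.

Ltac solve_bmeas := repeat first
  [assumption | exact: bmeas_cst | apply: bmeasD | apply: bmeasM].

Lemma bmeas_indic (A : set T) : measurable A -> bmeas (\1_A : T -> R).
Proof.
move=> mA; split; first exact: measurable_indic.
by exists 1 => x; rewrite indicE; case: (_ \in _); rewrite ?normr1 ?normr0.
Qed.

Lemma bmeas_sum (I : Type) (s : seq I) (F : I -> T -> R) :
  (forall i, bmeas (F i)) -> bmeas (fun x => \sum_(i <- s) F i x).
Proof.
move=> bF; elim: s => [|i s ih].
  by under eq_fun do rewrite big_nil; exact: bmeas_cst.
by under eq_fun do rewrite big_cons; exact: bmeasD.
Qed.

Lemma bmeas_prod (I : Type) (s : seq I) (F : I -> T -> R) :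
  (forall i, bmeas (F i)) -> bmeas (fun x => \prod_(i <- s) F i x).
Proof.
move=> bF; elim: s => [|i s ih].
  by under eq_fun do rewrite big_nil; exact: bmeas_cst.
by under eq_fun do rewrite big_cons; exact: bmeasM.
Qed.

Lemma mean_cst k : mean (fun=> k) = k.
Proof.
rewrite /mean Rintegral_cst// (_ : fine _ = 1) ?mulr1//.
exact: (congr1 fine (probability_setT Q)).
Qed.

Lemma meanD f g : bmeas f -> bmeas g -> mean (fun x => f x + g x) = mean f + mean g.
Proof. by move=> bf bg; rewrite /mean RintegralD//; exact: bmeas_integrable. Qed.

Lemma meanZ k f : bmeas f -> mean (fun x => k * f x) = k * mean f.
Proof. by move=> bf; rewrite /mean RintegralZl//; exact: bmeas_integrable. Qed.

Lemma meanB f g : bmeas f -> bmeas g -> mean (fun x => f x - g x) = mean f - mean g.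
Proof.
move=> bf bg; under eq_fun do rewrite -mulN1r.
by rewrite meanD// ?meanZ ?mulN1r//; exact: bmeasZ.
Qed.

Lemma mean_sum (I : Type) (s : seq I) (F : I -> T -> R) :
  (forall i, bmeas (F i)) ->
  mean (fun x => \sum_(i <- s) F i x) = \sum_(i <- s) mean (F i).
Proof.
move=> bF; elim: s => [|i s ih].
  by rewrite big_nil; under eq_fun do rewrite big_nil; rewrite mean_cst.
rewrite big_cons -ih; under eq_fun do rewrite big_cons.
by rewrite meanD//; exact: bmeas_sum.
Qed.

Lemma le_mean f g : bmeas f -> bmeas g -> (forall x, f x <= g x) -> mean f <= mean g.
Proof.
by move=> bf bg fg; apply: le_Rintegral => //; exact: bmeas_integrable.
Qed.

Lemma ae_eq_mean f g : bmeas f -> bmeas g -> {ae Q, forall x, f x = g x} ->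
  mean f = mean g.
Proof.
move=> [mf _] [mg _] fg; congr fine; apply: ae_eq_integral => //.
- exact/measurable_EFinP.
- exact/measurable_EFinP.
- by apply: filterS fg => x -> .
Qed.

Lemma mean_dist f g k : bmeas f -> bmeas g -> (forall x, `|f x - g x| <= k) ->
  `|mean f - mean g| <= k.
Proof.
move=> bf bg fg; rewrite ler_distlC -{1 2}(mean_cst k) -meanB -?meanD//;
  try exact: bmeas_cst.
have H x := fg x; apply/andP; split; apply: le_mean => //.
- by under eq_fun do rewrite -mulN1r; apply: bmeasD => //; apply: bmeasZ; exact: bmeas_cst.
- by move=> x; have := fg x; rewrite ler_distlC => /andP[].
- by apply: bmeasD => //; exact: bmeas_cst.
- by move=> x; have := fg x; rewrite ler_distlC => /andP[].
Qed.

Lemma mean_norm_le f k : bmeas f -> (forall x, `|f x| <= k) -> `|mean f| <= k.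
Proof.
move=> bf fk; rewrite -[mean f]subr0 -(mean_cst 0).
by apply: mean_dist => //; [exact: bmeas_cst|move=> x; rewrite subr0].
Qed.

Lemma mean_ge0 f : (forall x, 0 <= f x) -> 0 <= mean f.
Proof. by move=> f0; apply: Rintegral_ge0. Qed.

Lemma mean_indic (A : set T) : measurable A -> mean (\1_A) = fine (Q A).
Proof. by move=> mA; rewrite /mean /Rintegral integral_indic// setIT. Qed.

(* Chebyshev's association inequality, obtained by integrating
   [(f x - f y) * (g x - g y) >= 0] over [x] and then over [y]. *)
Lemma mean_chebyshev f g : bmeas f -> bmeas g ->
  (forall x y, 0 <= (f x - f y) * (g x - g y)) ->
  mean f * mean g <= mean (fun x => f x * g x).
Proof.
move=> bf bg fg; 
pose m := mean (fun x => f x * g x).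
have step y : 0 <= (m + f y * g y) + (- f y * mean g + - g y * mean f).
  rewrite -(mean_cst (f y * g y)) -!meanZ// -!meanD//; try by solve_bmeas.
  apply: mean_ge0 => x; have := fg x y; lra.
have : 0 <= mean (fun y => (m + f y * g y) + (- mean g * f y + - mean f * g y)).
  by apply: mean_ge0 => y; have := step y; lra.
rewrite !meanD ?meanZ ?mean_cst//; try by solve_bmeas.
rewrite -/m; lra.
Qed.

End BoundedMeasurable.

(** * Averages over finitely many sites *)

Section SiteAverages.
Context {R : realType}.
Variable eta : probability (measurableTypeR R) R.
Local Notation env := (int -> R).
Implicit Types (e : env) (F G : env -> R) (s : seq int).

Definition blip_by (K : R) F := (forall e, `|F e| <= K) /\
  (forall (k : R) e e', (forall x, `|e x - e' x| <= k) -> `|F e - F e'| <= K * k).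

Definition blip F := exists K, blip_by K F.

Definition upd e (x : int) (y : R) : env := fun z => if z == x then y else e z.

Lemma blip_cst k : blip (fun=> k).
Proof. exists `|k|; split=> // k' e e' ?; rewrite subrr normr0 mulr_ge0//.
by rewrite (le_trans (normr_ge0 (e 0 - e' 0))).
Qed.

Lemma blipD F G : blip F -> blip G -> blip (fun e => F e + G e).
Proof.
move=> [K [FK FL]] [M [GM GL]]; exists (K + M); split=> [e|k e e' ee'].
  by rewrite (le_trans (ler_normD _ _))// lerD.
rewrite mulrDl opprD addrACA; apply: le_trans (ler_normD _ _) _.
by apply: lerD; [exact: FL|exact: GL].
Qed.

Lemma blipM F G : blip F -> blip G -> blip (fun e => F e * G e).
Proof.
move=> [K [FK FL]] [M [GM GL]].
have K0 : 0 <= K by rewrite (le_trans (normr_ge0 (F (fun=> 0)))).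
have M0 : 0 <= M by rewrite (le_trans (normr_ge0 (G (fun=> 0)))).
exists (K * M + (K * M)); split=> [e|k e e' ee'].
  by rewrite normrM (@le_trans _ _ (K * M)) ?ler_pM// lerDl mulr_ge0.
have -> : F e * G e - F e' * G e' = F e * (G e - G e') + (F e - F e') * G e' by ring.
rewrite (mulrDl (K * M)); apply: le_trans (ler_normD _ _) _; rewrite !normrM; apply: lerD.
  by rewrite -mulrA ler_pM//; exact: GL.
by rewrite mulrAC ler_pM//; exact: FL.
Qed.

Lemma blip_upd F e x : blip F -> bmeas (fun y => F (upd e x y) : R).
Proof.
move=> [K [FK FL]]; split; last by exists K.
apply: continuous_measurable_fun => y; apply/cvgrPdist_le => /= eps eps0.
have K0 : 0 <= K by rewrite (le_trans (normr_ge0 (F e))).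
near=> z; apply: (@le_trans _ _ (K * `|y - z|)).
  apply: FL => x'; rewrite /upd; case: ifP => // _.
  by rewrite subrr normr0.
rewrite (@le_trans _ _ ((K + 1) * `|y - z|)) ?ler_wpM2r ?lerDl//.
rewrite -ler_pdivlMl ?ltr_wpDl//; near: z.
by apply: cvgr_dist_le => //; rewrite mulr_gt0// invr_gt0 ltr_wpDl.
Unshelve. all: by end_near. Qed.

Fixpoint savg s F e : R :=
  if s is x :: s' then mean eta (fun y => savg s' F (upd e x y)) else F e.

Lemma blip_by_savg K s F : blip_by K F -> blip_by K (savg s F).
Proof.
move=> bF; elim: s => [//|x s [ihK ihL]] /=.
have bs : blip (savg s F) by exists K.
split => [e|k e e' ee'].
  by apply: mean_norm_le => //; exact: blip_upd.
apply: mean_dist => [||y]; try exact: blip_upd.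
apply: ihL => z; rewrite /upd; case: ifP => // _.
by rewrite subrr normr0 (le_trans _ (ee' 0)).
Qed.

Lemma blip_savg s F : blip F -> blip (savg s F).
Proof. by move=> [K bF]; exists K; exact: blip_by_savg. Qed.

Lemma savg_cat s s' F e : savg (s ++ s') F e = savg s (savg s' F) e.
Proof. by elim: s e => [//|x s ih] e /=; congr mean; apply/funext. Qed.

Lemma le_savg s F G e : blip F -> blip G -> (forall e, F e <= G e) ->
  savg s F e <= savg s G e.
Proof.
move=> bF bG FG; elim: s e => [//|x s ih] e /=.
by apply: le_mean => //; apply: blip_upd; exact: blip_savg.
Qed.

Lemma savg_cst s k e : savg s (fun=> k) e = k.
Proof.
elim: s e => [//|x s ih] e /=; rewrite -[RHS](mean_cst eta).
by congr mean; apply/funext.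
Qed.

Lemma savgD s F G e : blip F -> blip G ->
  savg s (fun e => F e + G e) e = savg s F e + savg s G e.
Proof.
move=> bF bG; elim: s e => [//|x s ih] e /=.
under eq_fun do rewrite ih.
by rewrite meanD//; apply: blip_upd; exact: blip_savg.
Qed.

Lemma savgM s F G e : blip F -> blip G ->
  (forall e x y, x \in s -> G (upd e x y) = G e) ->
  savg s (fun e => G e * F e) e = G e * savg s F e.
Proof.
move=> bF bG Gs; elim: s e Gs => [//|x s ih] e Gs /=.
rewrite -meanZ; last by apply: blip_upd; exact: blip_savg.
congr mean; apply/funext => y; rewrite ih; first by rewrite Gs// mem_head.
by move=> e' x' y' x's; rewrite Gs// inE x's orbT.
Qed.

Lemma savgZ s F k e : blip F -> savg s (fun e => k * F e) e = k * savg s F e.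
Proof. by move=> bF; rewrite (@savgM s F (fun=> k))//; exact: blip_cst. Qed.

Definition monotone F := forall e e', (forall x, e x <= e' x) -> F e <= F e'.

Lemma le_upd e x (y y' : R) : y <= y' -> forall z, upd e x y z <= upd e x y' z.
Proof. by move=> yy' z; rewrite /upd; case: ifP. Qed.

Lemma monotone_savg s F : blip F -> monotone F -> monotone (savg s F).
Proof.
move=> bF mF; elim: s => [//|x s ih] e e' ee' /=.
apply: le_mean => [||y]; try by apply: blip_upd; exact: blip_savg.
by apply: ih => z; rewrite /upd; case: ifP.
Qed.

Lemma savg_harris s F G e : blip F -> blip G -> monotone F -> monotone G ->
  savg s F e * savg s G e <= savg s (fun e => F e * G e) e.
Proof.
move=> bF bG mF mG; elim: s e => [//|x s ih] e /=.
have bsF := blip_savg s bF; have bsG := blip_savg s bG.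
have bFG := blipM bF bG; have bsFG := blip_savg s bFG.
apply: le_trans (mean_chebyshev eta (blip_upd e x bsF) (blip_upd e x bsG) _) _ => /=.
  move=> y y'; have [yy'|/ltW yy'] := leP y y'.
    by rewrite mulr_le0// subr_le0; apply: monotone_savg => //; exact: le_upd.
  by rewrite mulr_ge0// subr_ge0; apply: monotone_savg => //; exact: le_upd.
apply: le_mean => [||y]; [by apply: bmeasM; exact: blip_upd|exact: blip_upd|exact: ih].
Qed.

Definition local_on s F := forall e e', {in s, e =1 e'} -> F e = F e'.

End SiteAverages.

Section AlmostEverywhere.
Context {d : measure_display} {T : measurableType d} {R : realType}.
Variable Q : probability T R.
Implicit Types f g : T -> R.

Lemma ae_le_mean f g : bmeas f -> bmeas g -> {ae Q, forall x, f x <= g x} ->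
  mean Q f <= mean Q g.
Proof.
move=> bf bg fg; have bm : bmeas (f \min g).
  move: bf bg => [mf [M fM]] [mg [N gN]]; split; first exact: measurable_minr.
  exists (M + N) => x /=; rewrite /Num.min; case: ifP => _.
    by rewrite (le_trans (fM x))// lerDl (le_trans (normr_ge0 (g x))).
  by rewrite (le_trans (gN x))// lerDr (le_trans (normr_ge0 (f x))).
rewrite (_ : mean Q f = mean Q (f \min g)).
  by apply: le_mean => // x /=; rewrite ge_min lexx orbT.
by apply: ae_eq_mean => //; apply: filterS fg => x /= /min_idPl.
Qed.

Lemma ae_mean_dist f g k : bmeas f -> bmeas g ->
  {ae Q, forall x, `|f x - g x| <= k} -> `|mean Q f - mean Q g| <= k.
Proof.
move=> bf bg fg; have bk := bmeas_cst (T := T) k; have bk' := bmeas_cst (T := T) (- k).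
rewrite ler_distlC -{1 2}(mean_cst Q k) -meanB -?meanD//.
apply/andP; split; apply: ae_le_mean => //.
- by under eq_fun do rewrite -mulN1r; apply: bmeasD => //; exact: bmeasZ.
- by apply: filterS fg => x; rewrite ler_distlC => /andP[].
- exact: bmeasD.
- by apply: filterS fg => x; rewrite ler_distlC => /andP[].
Qed.

Definition node (b : R) (n j : nat) := b + j%:R * (- b / n%:R).

Definition cell (b : R) (n j : nat) := `[node b n j, node b n j.+1[%classic.

Lemma mean_grid (b K : R) (n : nat) (Y : T -> R) (H : R -> T -> R) :
  b < 0 -> (0 < n)%N -> 0 <= K -> measurable_fun setT Y ->
  {ae Q, forall w, b <= Y w <= 0} ->
  (forall y, bmeas (H y)) -> bmeas (fun w => H (Y w) w) ->
  (forall y y' w, `|H y w - H y' w| <= K * `|y - y'|) ->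
  `|mean Q (fun w => H (Y w) w) -
    \sum_(j < n.+1) mean Q (fun w => \1_(cell b n j) (Y w) * H (node b n j) w)|
  <= K * (- b / n%:R).
Proof.
move=> b0 n0 K0 mY Yb bH bHY HL.
rewrite /cell /node; set delta := - b / n%:R.
pose J (j : nat) := `[b + j%:R * delta, b + j.+1%:R * delta[%classic.
have n0' : 0 < n%:R :> R by rewrite ltr0n.
have d0 : 0 < delta by rewrite divr_gt0// oppr_gt0.
have bJ (j : 'I_n.+1) : bmeas (fun w => \1_(J j) (Y w) * H (b + j%:R * delta) w).
  apply: bmeasM => //; split.
    apply: measurableT_comp => //; apply: measurable_indic; exact: measurable_itv.
  by exists 1 => x; rewrite indicE; case: (_ \in _); rewrite ?normr1 ?normr0.
rewrite -mean_sum//; apply: ae_mean_dist => //; first exact: bmeas_sum.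
apply: filterS Yb => w /andP[bY Y0].
have z0 : 0 <= (Y w - b) / delta by rewrite divr_ge0 ?subr_ge0// ltW.
have /andP[j1 j2] := truncn_itv z0; set j := Num.trunc _ in j1 j2.
have jn : (j < n.+1)%N.
  rewrite ltnS -(ler_nat R) (le_trans j1)// ler_pdivrMr// /delta mulrCA divff ?gt_eqF//; lra.
rewrite ler_pdivlMr// in j1; rewrite ltr_pdivrMr// in j2.
rewrite (bigD1 (Ordinal jn))//= big1 ?addr0.
  rewrite indicE mem_set ?mul1r//=; last first.
    by rewrite /J /= in_itv/=; apply/andP; split; lra.
  rewrite (le_trans (HL _ _ _))// ler_wpM2l// ger0_norm; first by lra.
  by lra.
move=> i ij; rewrite indicE memNset ?mul0r// /J/= in_itv/= => /andP[h1 h2].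
move/negP : ij; apply; apply/eqP/val_inj => /=; apply/eqP.
have : (i < j.+1)%N by rewrite -(ltr_nat R) -(ltr_pM2r d0); lra.
have : (j < i.+1)%N by rewrite -(ltr_nat R) -(ltr_pM2r d0); lra.
by rewrite !ltnS eqn_leq => -> ->.
Qed.

End AlmostEverywhere.

Section Environment.
Context {d : measure_display} {T : measurableType d} {R : realType}.
Variables (P : probability T R) (b : R) (eta : probability (measurableTypeR R) R).
Variable xi : int -> {RV P >-> R}.
Hypotheses (b_lt0 : b < 0) (eta_supp : eta `[b, 0]%classic = 1%E).
Hypothesis xi_iid : iid_with_law eta xi.
Local Notation env := (int -> R).
Implicit Types (e : env) (F G : env -> R) (s r : seq int).

Definition envmeas F := forall X : int -> T -> R,
  (forall x, measurable_fun setT (X x)) -> measurable_fun setT (fun w => F (X ^~ w)).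

Fixpoint upds e s (v : env) : env :=
  if s is x :: s' then upds (upd e x (v x)) s' v else e.

Lemma upds_notin e s v x : x \notin s -> upds e s v x = e x.
Proof.
elim: s e => [//|y s ih] e /=; rewrite inE negb_or => /andP[xy xs].
by rewrite ih// /upd (negbTE xy).
Qed.

Lemma upds_in e s v x : x \in s -> upds e s v x = v x.
Proof.
elim: s e => [//|y s ih] e /=; rewrite inE.
have [xs _|xs] := boolP (x \in s); first exact: ih.
by rewrite orbF upds_notin// /upd => xy; rewrite xy (eqP xy).
Qed.

Lemma law_xi x A : measurable A -> P (xi x @^-1` A) = eta A.
Proof. by move=> mA; have [_ /(_ x A mA)] := xi_iid. Qed.

Lemma eta_supp_setC : eta (~` `[b, 0]%classic) = 0%E.
Proof.
apply: etrans (probability_setC eta (measurable_itv `[b, 0])) _.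
by rewrite eta_supp subee.
Qed.

Lemma xi_supp x : {ae P, forall w, b <= xi x w <= 0}.
Proof.
exists (xi x @^-1` (~` `[b, 0]%classic)); split.
- rewrite -[X in measurable X]setTI; apply: measurable_funP => //.
  by apply: measurableC; exact: measurable_itv.
- by apply: etrans (law_xi _ _) eta_supp_setC; apply: measurableC; exact: measurable_itv.
- by move=> w /= H; contradict H; rewrite in_itv /= in H.
Qed.

Lemma eta_supp_ae : {ae eta, forall y, b <= y <= 0}.
Proof.
exists (~` `[b, 0]%classic); split.
- by apply: measurableC; exact: measurable_itv.
- exact: eta_supp_setC.
- by move=> w /= H; contradict H; rewrite in_itv /= in H.
Qed.

Lemma fin_eta_itv01 A : measurable A -> 0 <= fine (eta A) <= 1.
Proof.
move=> mA; rewrite fine_ge0//= -lee_fin fineK ?fin_num_measure//.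
exact: probability_le1.
Qed.

Lemma mean_prod_indic r (A : int -> set R) : uniq r -> (forall x, measurable (A x)) ->
  mean P (fun w => \prod_(z <- r) \1_(A z) (xi z w)) = \prod_(z <- r) fine (eta (A z)).
Proof.
move=> ur mA; have [ind _] := xi_iid.
rewrite (_ : (fun w => _) = \1_(\bigcap_(x in [set` r]) (xi x @^-1` A x))); last first.
  apply/funext => w; rewrite indicE.
  have [/= H|/= H] := boolP (w \in _).
    rewrite big_seq big1// => z zr; rewrite indicE mem_set//.
    by move: H; rewrite inE => /(_ z zr).
  have [z [zr Az]] : exists z, z \in r /\ ~ A z (xi z w).
    apply: contrapT => /forallNP K; move/negP: H; apply; rewrite inE => z zr.
    by apply: contrapT => Az; apply: (K z).
  by rewrite (big_rem z)//= indicE memNset// mul0r.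
rewrite mean_indic; last first.
  apply: fin_bigcap_measurable => // z _.
  by rewrite -[X in measurable X]setTI; apply: measurable_funP.
rewrite ind// (eq_bigr (fun z => (fine (eta (A z)))%:E)).
  by rewrite prodEFin.
by move=> z _; rewrite fineK ?fin_num_measure//; [exact: law_xi|exact: mA].
Qed.

Lemma upds_dist s v (e e' : env) (k : R) : (forall x, `|e x - e' x| <= k) ->
  forall x, `|upds e s v x - upds e' s v x| <= k.
Proof.
move=> ee' x; have [xs|xs] := boolP (x \in s); last by rewrite !upds_notin.
by rewrite !upds_in// subrr normr0 (le_trans (normr_ge0 _) (ee' x)).
Qed.

Lemma bmeas_upds F s (X : int -> T -> R) :
  blip F -> envmeas F -> (forall x, measurable_fun setT (X x)) ->
  forall e x, bmeas (fun w => F (upds (upd e x (X x w)) s (xi^~ w))).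
Proof.
move=> [K [FK FL]] mF mX e x; split; last by exists K.
apply: (mF (fun z w => upds (upd e x (X x w)) s (xi^~ w) z)) => z.
have [zs|zs] := boolP (z \in s).
  by under eq_fun do rewrite upds_in//; exact: measurable_funP.
under eq_fun do rewrite upds_notin// /upd.
by have [_|_] := eqVneq z x; [exact: mX|exact: measurable_cst].
Qed.

Lemma bmeas_indic_xi z (A : set R) : measurable A ->
  bmeas (fun w => \1_A (xi z w) : R).
Proof.
move=> mA; split; first by apply: measurableT_comp => //; exact: measurable_indic.
by exists 1 => w; rewrite indicE; case: (_ \in _); rewrite ?normr1 ?normr0.
Qed.

(* Sites are moved one at a time from [s] to the indicator part [r], after
   discretizing the corresponding coordinate. *)
Lemma mean_upds r s (A : int -> set R) F e : uniq (r ++ s) ->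
  (forall x, measurable (A x)) -> blip F -> envmeas F ->
  mean P (fun w => (\prod_(z <- r) \1_(A z) (xi z w)) * F (upds e s (xi^~ w))) =
  (\prod_(z <- r) fine (eta (A z))) * savg eta s F e.
Proof.
move=> urs mA bF mF; elim: s r A e urs mA => [|x s ih] r A e urs mA.
  rewrite cats0 in urs; rewrite /= -mean_prod_indic// mulrC -meanZ.
    by congr mean; apply/funext => w; rewrite mulrC.
  by apply: bmeas_prod => z; exact: bmeas_indic_xi.
have [K [FK FL]] := bF; have K0 : 0 <= K by rewrite (le_trans (normr_ge0 (F e))).
have urs' : uniq (x :: r ++ s) by rewrite -(uniq_catCA r [:: x] s).
have xr : x \notin r by move: urs' => /=; rewrite mem_cat negb_or => /andP[/andP[]].
pose pi w := \prod_(z <- r) \1_(A z) (xi z w) : R.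
have bpi : bmeas pi by apply: bmeas_prod => z; exact: bmeas_indic_xi.
have pi01 w : 0 <= pi w <= 1.
  have i01 z : 0 <= (\1_(A z) (xi z w) : R) <= 1.
    by rewrite indicE; case: (_ \in _); rewrite ?ler01 ?lexx.
  apply/andP; split; [apply: prodr_ge0|apply: prodr_ile1] => z _; last exact: i01.
  by have /andP[] := i01 z.
have c01 : 0 <= \prod_(z <- r) fine (eta (A z)) <= 1.
  apply/andP; split; [apply: prodr_ge0|apply: prodr_ile1] => z _;
    last exact: (fin_eta_itv01 (mA z)).
  by have /andP[] := fin_eta_itv01 (mA z).
have key n : (0 < n)%N -> `|mean P (fun w => pi w * F (upds e (x :: s) (xi^~ w))) -
    (\prod_(z <- r) fine (eta (A z))) * savg eta (x :: s) F e| <= 2 * (K * (- b / n%:R)).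
  move=> n0.
  have mup y : bmeas (fun w => F (upds (upd e x y) s (xi^~ w))).
    exact: (bmeas_upds s (X := fun _ _ => y)).
  have LF y y' w : `|F (upds (upd e x y) s (xi^~ w)) - F (upds (upd e x y') s (xi^~ w))|
      <= K * `|y - y'|.
    apply: FL; apply: upds_dist => z; rewrite /upd.
    by have [_|_] := eqVneq z x => //; rewrite subrr normr0.
  have bs := blip_savg eta s bF.
  have H1 : `|mean P (fun w => pi w * F (upds e (x :: s) (xi^~ w))) -
     \sum_(j < n.+1) (\prod_(z <- r) fine (eta (A z))) * (fine (eta (cell b n j)) *
        savg eta s F (upd e x (node b n j)))| <= K * (- b / n%:R).
    have := @mean_grid _ _ _ P b K n (xi x)
      (fun y w => pi w * F (upds (upd e x y) s (xi^~ w))) b_lt0 n0 K0.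
    rewrite (eq_bigr (fun j : 'I_n.+1 => (\prod_(z <- r) fine (eta (A z))) *
       (fine (eta (cell b n j)) * savg eta s F (upd e x (node b n j))))); last first.
      move=> j _; pose A' z := if z == x then cell b n j else A z.
      have mA' z : measurable (A' z).
        by rewrite /A'; case: ifP => _; [exact: measurable_itv|exact: mA].
      have := ih (x :: r) A' (upd e x (node b n j)) urs' mA'.
      have A'r z : z \in r -> A' z = A z.
        by rewrite /A'; case: eqP => // ->; rewrite (negbTE xr).
      rewrite big_cons {2}/A' eqxx (eq_big_seq (fun z => fine (eta (A z)))); last first.
        by move=> z zr; rewrite A'r.
      rewrite -mulrA mulrCA => <-; congr mean; apply/funext => w.
      rewrite big_cons {1}/A' eqxx (eq_big_seq (fun z => \1_(A z) (xi z w))); last first.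
        by move=> z zr; rewrite A'r.
      by rewrite mulrA.
    apply => //.
    - exact: xi_supp.
    - by move=> y; apply: bmeasM.
    - by apply: bmeasM => //; exact: (bmeas_upds s (X := fun x w => xi x w)).
    - move=> y y' w; rewrite -mulrBr normrM.
      have /andP[p0 p1] := pi01 w; rewrite ger0_norm// (le_trans _ (LF y y' w))//.
      by rewrite ler_piMl ?normr_ge0.
  have H2 : `|savg eta (x :: s) F e -
     \sum_(j < n.+1) (fine (eta (cell b n j)) *
        savg eta s F (upd e x (node b n j)))| <= K * (- b / n%:R).
    have := @mean_grid _ _ _ eta b K n id
      (fun y _ => savg eta s F (upd e x y)) b_lt0 n0 K0.
    rewrite (eq_bigr (fun j : 'I_n.+1 =>
       (fine (eta (cell b n j)) * savg eta s F (upd e x (node b n j))))); last first.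
      move=> j _; rewrite mulrC -(mean_indic eta (measurable_itv _)).
      rewrite -(meanZ eta _ (bmeas_indic (measurable_itv _))).
      by congr mean; apply/funext => y; rewrite mulrC.
    apply => //.
    - exact: eta_supp_ae.
    - by move=> y; exact: bmeas_cst.
    - exact: blip_upd.
    - move=> y y' _; have [_ sL] := blip_by_savg eta s (conj FK FL).
      apply: sL => z; rewrite /upd.
      by have [_|_] := eqVneq z x => //; rewrite subrr normr0.
  rewrite -mulr_sumr in H1; have /andP[c0 c1] := c01.
  set S := \sum_(j < n.+1) _ in H1 H2.
  apply: (le_trans (ler_distD (\prod_(z <- r) fine (eta (A z)) * S) _ _)).
  rewrite mulr2n mulrDl mul1r; apply: (lerD H1).
  rewrite -mulrBr normrM ger0_norm// distrC.
  by rewrite (le_trans _ H2)// ler_piMl ?normr_ge0.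
apply/eqP; rewrite -subr_eq0 -normr_eq0 eq_le normr_ge0 andbT.
apply/ler_addgt0Pr => eps eps0; rewrite add0r.
pose n := (Num.trunc (2 * (K * - b) / eps)).+1.
have := key n isT; rewrite -/pi => /le_trans; apply.
have n0 : 0 < n%:R :> R by rewrite ltr0n.
rewrite (_ : 2 * _ = 2 * (K * - b) / n%:R); last by rewrite !mulrA.
by rewrite ler_pdivrMr// [eps * _]mulrC -ler_pdivrMr//; apply/ltW/truncnS_gt.
Qed.

Lemma mean_environment s F e : uniq s -> blip F -> envmeas F -> local_on s F ->
  mean P (fun w => F (xi^~ w)) = savg eta s F e.
Proof.
move=> us bF mF lF.
have := mean_upds (r := [::]) (A := fun=> setT) e us (fun=> measurableT) bF mF.
rewrite big_nil mul1r => <-; congr mean; apply/funext => w.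
rewrite big_nil mul1r; apply: lF => x xs; by rewrite upds_in.
Qed.

End Environment.

(** * The polymer *)

Section Polymer.
Context {R : realType}.
Variables (b rr ll : R).
Local Notation env := (int -> R).
Implicit Types (e : env) (f g : int -> R) (F G : env -> R) (n m : nat) (x z : int).

(* [step] is [kappa * Delta_h + xi + total_rate] with [xi] clamped to [b, 0]: the
   clamping makes [walk] bounded and Lipschitz on all environments and does not
   change it almost surely, and the shift by [total_rate] makes it nonnegative
   and nondecreasing in the environment. *)
Definition clamp (y : R) : R := Num.max b (Num.min y 0).

Definition step e f x := rr * f (x + 1) + ll * f (x - 1) + (clamp (e x) - b) * f x.

Definition walk n e f : int -> R := iter n (step e) f.

Definition total_rate : R := rr + ll - b.

Lemma clamp_id y : b <= y <= 0 -> clamp y = y.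
Proof. by move=> /andP[by_ y0]; rewrite /clamp; move/min_idPl : y0 => ->; apply/max_idPr. Qed.

Lemma le_clamp y y' : y <= y' -> clamp y <= clamp y'.
Proof.
move=> yy'; rewrite /clamp ge_max !le_max lexx /= orbC.
by rewrite le_min !ge_min yy' lexx !orbT.
Qed.

Lemma clamp_dist y y' : `|clamp y - clamp y'| <= `|y - y'|.
Proof.
wlog yy' : y y' / y <= y'.
  by move=> H; have [/H//|/ltW/H] := leP y y'; rewrite distrC [X in _ <= X]distrC.
rewrite distrC [X in _ <= X]distrC !ger0_norm ?subr_ge0 ?le_clamp//.
rewrite /clamp /Num.max /Num.min; case: (ltP y 0) => ?; case: (ltP y' 0) => ?;
  case: (ltP b y) => ?; case: (ltP b y') => ?; case: (ltP b 0) => ?; lra.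
Qed.

Lemma walkS n e f x : walk n.+1 e f x = step e (walk n e f) x.
Proof. by []. Qed.

Lemma walkD n m e f : walk (n + m) e f = walk n e (walk m e f).
Proof. exact: iterD. Qed.

Lemma walk_sum n e x (I : Type) (s : seq I) (c : I -> R) (f : I -> int -> R) :
  walk n e (fun y => \sum_(i <- s) c i * f i y) x = \sum_(i <- s) c i * walk n e (f i) x.
Proof.
elim: n x => [//|n ih] x; rewrite walkS /step !ih !mulr_sumr -!big_split.
apply: eq_bigr => i _; rewrite walkS /step /=; ring.
Qed.

Lemma walkZ n e f (k : R) x : walk n e (fun y => k * f y) x = k * walk n e f x.
Proof. by elim: n x => [//|n ih] x; rewrite !walkS /step !ih; ring. Qed.

Lemma eq_walk n e e' f g x :
  (forall y, (`|y - x| <= n)%N -> e y = e' y /\ f y = g y) ->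
  walk n e f x = walk n e' g x.
Proof.
elim: n x => [|n ih] x H; first by have [|_ fx] := H x; [rewrite subrr|exact: fx].
have [|ex _] := H x; first by rewrite subrr.
rewrite !walkS /step ex.
by congr (_ * _ + _ * _ + _ * _); apply: ih => y yx; apply: H; lia.
Qed.

Lemma walk_shift n e f z x :
  walk n e f (x + z) = walk n (fun y => e (y + z)) (fun y => f (y + z)) x.
Proof.
elim: n x => [//|n ih] x; rewrite !walkS /step -!ih.
by rewrite -(addrAC x 1 z) -(addrAC x (-1) z).
Qed.

Lemma local_walk n f x s : (forall y, (`|y - x| <= n)%N -> y \in s) ->
  local_on s (fun e => walk n e f x).
Proof. by move=> H e e' ee'; apply: eq_walk => y /H ys; rewrite ee'. Qed.

Hypotheses (b_lt0 : b < 0) (rr_gt0 : 0 < rr) (ll_ge0 : 0 <= ll).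

Lemma clamp_itv y : b <= clamp y <= 0.
Proof. by rewrite /clamp le_max lexx ge_max (ltW b_lt0) ge_min lexx orbT. Qed.

Lemma total_rate_gt0 : 0 < total_rate.
Proof. by rewrite /total_rate; move: b_lt0 rr_gt0 ll_ge0 => *; lra. Qed.

Lemma weight_ge0 e x : 0 <= clamp (e x) - b.
Proof. by rewrite subr_ge0; have /andP[] := clamp_itv (e x). Qed.

Lemma le_walk n e f g x : (forall y, f y <= g y) -> walk n e f x <= walk n e g x.
Proof.
move=> fg; elim: n x => [//|n ih] x; rewrite !walkS /step.
by rewrite !lerD// ler_wpM2l//; [exact: ltW|exact: weight_ge0].
Qed.

Lemma walk_ge0 n e f x : (forall y, 0 <= f y) -> 0 <= walk n e f x.
Proof.
move=> f0; elim: n x => [//|n ih] x; rewrite walkS /step.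
by rewrite !addr_ge0// mulr_ge0// ?weight_ge0// ltW.
Qed.

Lemma walk_le n e x : walk n e (fun=> 1) x <= total_rate ^+ n.
Proof.
elim: n x => [|n ih] x; first by rewrite expr0.
have t0 : 0 <= total_rate ^+ n by rewrite exprn_ge0// ltW// total_rate_gt0.
have /andP[c1 c2] := clamp_itv (e x).
rewrite walkS /step exprS; set t := total_rate ^+ n in t0 ih *.
apply: le_trans (_ : rr * t + ll * t + (clamp (e x) - b) * t <= _).
  by rewrite !lerD// ler_wpM2l//; [exact: ltW|exact: weight_ge0].
rewrite /total_rate; nra.
Qed.

Lemma walk_ge n e x (k : R) : 0 <= k <= - b ->
  (forall y, (`|y - x| <= n)%N -> - k <= e y) ->
  (total_rate - k) ^+ n <= walk n e (fun=> 1) x.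
Proof.
have := b_lt0; have := rr_gt0; have := ll_ge0 => l0 r0 b0.
move=> /andP[k0 kb]; elim: n x => [|n ih] x ek; first by rewrite expr0.
have t0 : 0 <= (total_rate - k) ^+ n by rewrite exprn_ge0// /total_rate; lra.
rewrite walkS /step exprS; set t := (total_rate - k) ^+ n in t0 ih *.
have H1 : t <= walk n e (fun=> 1) (x + 1) by apply: ih => y yx; apply: ek; lia.
have H2 : t <= walk n e (fun=> 1) (x - 1) by apply: ih => y yx; apply: ek; lia.
have H3 : t <= walk n e (fun=> 1) x by apply: ih => y yx; apply: ek; lia.
have ck : - k <= clamp (e x).
  rewrite /clamp le_max le_min; apply/orP; right; rewrite oppr_le0 k0 andbT.
  by apply: ek; rewrite subrr.
apply: le_trans (_ : rr * t + ll * t + (clamp (e x) - b) * t <= _).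
  rewrite /total_rate; nra.
by rewrite !lerD// ler_wpM2l//; [exact: ltW|exact: weight_ge0].
Qed.

Lemma monotone_walk n f x : (forall y, 0 <= f y) -> monotone (fun e => walk n e f x).
Proof.
move=> f0 e e' ee'; elim: n x => [//|n ih] x; rewrite !walkS /step.
rewrite !lerD//; [by rewrite ler_wpM2l// ltW|exact: ler_wpM2l|].
by rewrite ler_pM// ?weight_ge0 ?walk_ge0// lerD2r le_clamp.
Qed.

Lemma blip_clamp x : blip (fun e => clamp (e x) - b).
Proof.
have b0 := b_lt0; exists (1 - b); split => [e|k e e' ee'].
  have /andP[c1 c2] := clamp_itv (e x); rewrite ger0_norm ?weight_ge0//; lra.
rewrite opprB addrA subrK (le_trans (clamp_dist _ _))// (le_trans (ee' x))//.
have := le_trans (normr_ge0 _) (ee' x); nra.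
Qed.

Lemma blip_walk n f x : blip (fun e => walk n e f x).
Proof.
elim: n x => [|n ih] x; first exact: blip_cst.
exact: blipD (blipD (blipM (blip_cst rr) (ih (x + 1)))
  (blipM (blip_cst ll) (ih (x - 1)))) (blipM (blip_clamp x) (ih x)).
Qed.

End Polymer.

Section RealPowers.
Context {R : realType}.
Implicit Types (x y p : R).

Lemma bernoulli_le x n : 0 <= x <= 1 -> 1 - n%:R * (1 - x) <= x ^+ n.
Proof.
move=> /andP[x0 x1]; elim: n => [|n ih]; first by rewrite expr0 mul0r subr0.
apply: le_trans (_ : x * (1 - n%:R * (1 - x)) <= _); last by rewrite exprS ler_wpM2l.
have : 0 <= n%:R * ((1 - x) * (1 - x)) by rewrite mulr_ge0// mulr_ge0// subr_ge0.
rewrite -natr1; lra.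
Qed.

Lemma powR_sub_le K p x y : 1 <= p -> 0 <= x -> x <= y -> y <= K ->
  y `^ p - x `^ p <= (Num.trunc p).+1%:R * K `^ (p - 1) * (y - x).
Proof.
move=> p1 x0 xy yK; have [y0|y0] := leP y 0.
  have -> : y = x by apply/eqP; rewrite eq_le xy (le_trans y0).
  by rewrite !subrr mulr0.
set N := (Num.trunc p).+1; pose z := x / y.
have z01 : 0 <= z <= 1 by rewrite divr_ge0 ?(ltW y0)//= ler_pdivrMr// mul1r.
have xz : x = z * y by rewrite /z divfK// gt_eqF.
have yp : y `^ p = y * y `^ (p - 1) by rewrite mulr_powRB1 ?(ltW y0)// (lt_le_trans _ p1).
have zN : 1 - N%:R * (1 - z) <= z `^ p.
  apply: le_trans (bernoulli_le N z01) _; have /andP[z0 z1] := z01.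
  rewrite -powR_mulrn//; move: z0; rewrite le_eqVlt => /predU1P[<-|z0].
    by rewrite !powR0// gt_eqF// (lt_le_trans _ p1).
  by apply: ger_powR; [rewrite z0 z1|apply/ltW/truncnS_gt].
have yK1 : y `^ (p - 1) <= K `^ (p - 1).
  by apply: ge0_ler_powR; rewrite ?nnegrE ?subr_ge0// ?ltW// (lt_le_trans y0).
rewrite {1}xz powRM ?(ltW y0)//; last by case/andP: z01.
apply: le_trans (_ : N%:R * y `^ (p - 1) * (y - x) <= _); last first.
  by rewrite ler_wpM2r ?subr_ge0// ler_wpM2l.
have -> : y `^ p - z `^ p * y `^ p = (1 - z `^ p) * (y * y `^ (p - 1)) by rewrite -yp; ring.
have -> : N%:R * y `^ (p - 1) * (y - x) = (N%:R * (1 - z)) * (y * y `^ (p - 1)).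
  by rewrite {1}xz; ring.
rewrite ler_wpM2r ?mulr_ge0 ?powR_ge0 ?(ltW y0)//; lra.
Qed.

Lemma powR_sum_le (I : eqType) (s : seq I) (x : I -> R) p : 0 < p ->
  (forall i, 0 <= x i) ->
  (\sum_(i <- s) x i) `^ p <= (size s)%:R `^ p * \sum_(i <- s) x i `^ p.
Proof.
move=> p0 x0; set S := \sum_(i <- s) x i `^ p.
have S0 : 0 <= S by apply: sumr_ge0 => i _; exact: powR_ge0.
have xS i : i \in s -> x i <= S `^ p^-1.
  move=> si; rewrite -[x i]powRr1// -(mulfV (lt0r_neq0 p0)).
  rewrite powRrM ge0_ler_powR ?nnegrE ?powR_ge0 ?invr_ge0 ?(ltW p0)//.
  by rewrite /S (big_rem i)//= lerDl sumr_ge0// => j _; exact: powR_ge0.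
have sS : \sum_(i <- s) x i <= (size s)%:R * S `^ p^-1.
  rewrite mulr_natl -iter_addr_0 -(count_predT s) -big_const_seq.
  by rewrite big_seq [leRHS]big_seq; apply: ler_sum => i /xS.
apply: le_trans (_ : ((size s)%:R * S `^ p^-1) `^ p <= _).
  by apply: ge0_ler_powR; rewrite ?nnegrE ?(ltW p0) ?sumr_ge0 ?mulr_ge0 ?powR_ge0.
by rewrite powRM ?powR_ge0// -powRrM mulVf ?gt_eqF// powRr1.
Qed.

End RealPowers.

Section Observables.
Context {R : realType}.
Local Notation env := (int -> R).
Implicit Types (F : env -> R).

Lemma blip_powR p F : 1 <= p -> (forall e, 0 <= F e) -> blip F ->
  blip (fun e => F e `^ p).
Proof.
move=> p1 F0 [K [FK FL]]; have K0 : 0 <= K := le_trans (normr_ge0 _) (FK (fun=> 0)).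
have FK' e : F e <= K by rewrite -(ger0_norm (F0 e)).
have p0 : 0 <= p by lra.
pose L := (Num.trunc p).+1%:R * K `^ (p - 1).
have L0 : 0 <= L by rewrite mulr_ge0 ?powR_ge0.
have FLp e e' : F e <= F e' -> `|F e `^ p - F e' `^ p| <= L * `|F e - F e'|.
  move=> ee'; rewrite distrC [`|F e - _|]distrC !ger0_norm ?subr_ge0//.
    exact: (powR_sub_le p1 (F0 e) ee' (FK' e')).
  by apply: ge0_ler_powR; rewrite ?nnegrE.
exists (K `^ p + L * K); split => [e|k e e' ee'].
  rewrite ger0_norm ?powR_ge0// (@le_trans _ _ (K `^ p))//.
    by apply: ge0_ler_powR; rewrite ?nnegrE.
  by rewrite lerDl mulr_ge0.
have k0 : 0 <= k := le_trans (normr_ge0 _) (ee' 0).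
apply: le_trans (_ : L * `|F e - F e'| <= _).
  by have [/FLp//|/ltW/FLp] := leP (F e) (F e'); rewrite distrC [`|F e' - _|]distrC.
rewrite mulrDl -mulrA ler_wpDl ?mulr_ge0 ?powR_ge0//.
by rewrite ler_wpM2l//; exact: FL.
Qed.

Context {d : measure_display} {T : measurableType d}.

Lemma envmeas_powR p F : envmeas (T := T) F -> envmeas (T := T) (fun e => F e `^ p).
Proof.
move=> mF X mX; apply: (measurableT_comp (f := fun x => x `^ p)) (mF X mX).
exact: measurable_powR.
Qed.

Lemma envmeas_walk (b rr ll : R) n f x : envmeas (T := T) (fun e => walk b rr ll n e f x).
Proof.
move=> X mX; elim: n x => [|n ih] x; first exact: measurable_cst.
have mc : measurable_fun setT (fun w => clamp b (X x w) - b).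
  apply: measurable_funB => //.
  by apply: measurable_maxr => //; apply: measurable_minr => //; exact: mX.
exact: (measurable_funD (measurable_funD (measurable_funM (measurable_cst rr) (ih (x + 1)))
  (measurable_funM (measurable_cst ll) (ih (x - 1)))) (measurable_funM mc (ih x))).
Qed.

End Observables.

Section Sites.
Implicit Types (M x y : int) (k n : nat).

Definition sites M k : seq int := [seq M + i.+1%:Z | i <- iota 0 k].

Definition box n : seq int := sites (- n.+1%:Z) (n + n).+1.

Lemma sites_uniq M k : uniq (sites M k).
Proof. by rewrite map_inj_uniq ?iota_uniq// => i j; lia. Qed.

Lemma mem_sites M k y : (y \in sites M k) = (M < y <= M + k%:Z).
Proof.
apply/mapP/idP => [[i]|H].
  by rewrite mem_iota => /andP[_ ik] ->; lia.
exists (absz (y - M)).-1; last by lia.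
by rewrite mem_iota; lia.
Qed.

Lemma mem_box n y : (y \in box n) = (`|y| <= n)%N.
Proof. by rewrite mem_sites; apply/idP/idP; lia. Qed.

Lemma sitesD M k k' : sites M (k + k') = sites M k ++ sites (M + k%:Z) k'.
Proof.
rewrite /sites iotaD map_cat add0n; congr (_ ++ _).
rewrite -[X in iota X]addn0 iotaDl -map_comp; apply: eq_map => i /=; lia.
Qed.

Lemma sitesS M k : sites M k.+1 = (M + 1) :: sites (M + 1) k.
Proof. exact: (sitesD M 1 k). Qed.

Lemma size_box n : size (box n) = (n + n).+1.
Proof. by rewrite size_map size_iota. Qed.

End Sites.

(** * Moments of the polymer *)

Section Moments.
Context {d : measure_display} {T : measurableType d} {R : realType}.
Variables (P : probability T R) (b : R) (eta : probability (measurableTypeR R) R).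
Variable xi : int -> {RV P >-> R}.
Hypotheses (b_lt0 : b < 0) (eta_supp : eta `[b, 0]%classic = 1%E).
Hypothesis xi_iid : iid_with_law eta xi.
Variables (rr ll : R).
Hypotheses (rr_gt0 : 0 < rr) (ll_ge0 : 0 <= ll).
Local Notation env := (int -> R).
Implicit Types (e : env) (F G : env -> R) (s r : seq int).

Definition observable n F :=
  [/\ blip F, envmeas (T := T) F & local_on (box n) F].

Definition annealed F : R := mean P (fun w => F (xi^~ w)).

Lemma observable_bmeas n F : observable n F -> bmeas (fun w => F (xi^~ w)).
Proof.
move=> [[K [FK _]] mF _]; split; last by exists K.
by apply: (mF (fun x w => xi x w)) => x; exact: measurable_funP.
Qed.

Lemma annealedE n F e : observable n F -> annealed F = savg eta (box n) F e.
Proof.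
by move=> [bF mF lF]; apply: (mean_environment b_lt0 eta_supp xi_iid) => //; exact: sites_uniq.
Qed.

Lemma observableM n F G : observable n F -> observable n G ->
  observable n (fun e => F e * G e).
Proof.
move=> [bF mF lF] [bG mG lG]; split; first exact: blipM.
  by move=> X mX; apply: measurable_funM; [exact: mF|exact: mG].
by move=> e e' ee'; rewrite (lF _ _ ee') (lG _ _ ee').
Qed.

Lemma observable_walk n m f x : (`|x| + n <= m)%N ->
  observable m (fun e => walk b rr ll n e f x).
Proof.
move=> xnm; split; [exact: (blip_walk _ _ b_lt0)|exact: envmeas_walk|].
by apply: local_walk => y yx; rewrite mem_box; lia.
Qed.

Lemma observable_powR n p F : 1 <= p -> (forall e, 0 <= F e) -> observable n F ->
  observable n (fun e => F e `^ p).
Proof.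
move=> p1 F0 [bF mF lF]; split; [exact: blip_powR|exact: envmeas_powR|].
by move=> e e' ee'; rewrite (lF _ _ ee').
Qed.

Lemma annealed_harris n F G : observable n F -> observable n G ->
  monotone F -> monotone G ->
  annealed F * annealed G <= annealed (fun e => F e * G e).
Proof.
move=> oF oG mF mG; rewrite !(@annealedE n _ (fun=> 0))//; last exact: observableM.
by have [bF _ _] := oF; have [bG _ _] := oG; exact: savg_harris.
Qed.

Lemma savg_shift s F z e : savg eta s (fun e => F (fun y => e (y + z))) e =
  savg eta [seq x - z | x <- s] F (fun y => e (y + z)).
Proof.
elim: s e => [//|x s ih] e /=; congr mean; apply/funext => y; rewrite ih.
by congr savg; apply/funext => x'; rewrite /upd [x' == _]eq_sym subr_eq eq_sym.
Qed.

Lemma annealed_shift n F z : observable n F ->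
  annealed (fun e => F (fun y => e (y + z))) = annealed F.
Proof.
move=> [bF mF lF]; set s := [seq x + z | x <- box n].
have us : uniq s by rewrite map_inj_uniq ?sites_uniq//; exact: addIr.
rewrite (@annealedE n F (fun y => (fun=> 0) (y + z)))//.
apply: etrans (mean_environment b_lt0 eta_supp xi_iid (s := s)
  (F := fun e => F (fun y => e (y + z))) (fun=> 0) us _ _ _) _; last first.
- rewrite savg_shift /s -map_comp; congr savg.
  by rewrite -[RHS]map_id; apply: eq_map => x /=; rewrite addrK.
- by move=> e e' ee'; apply: lF => y yn; apply: ee'; exact: (map_f (fun x => x + z)).
- by move=> X mX; apply: (mF (fun y => X (y + z))) => x.
- have [K [FK FL]] := bF; exists K; split => [e|k e e' ee']; first exact: FK.
  by apply: FL.
Qed.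

Definition moment (p : R) n : R := annealed (fun e => walk b rr ll n e (fun=> 1) 0 `^ p).

Let delta z : int -> R := fun y => (y == z)%:R.

Lemma moment_supermul p n m : 1 <= p ->
  moment p n * moment p m <= (n + n).+1%:R `^ (p + 1) * moment p (n + m).
Proof.
move=> p1; have p0 : 0 < p by lra.
have delta0 z y : 0 <= delta z y by rewrite /delta.
pose g z e := walk b rr ll n e (delta z) 0.
pose a k x e := walk b rr ll k e (fun=> 1) x.
have g0 z e : 0 <= g z e by exact: walk_ge0.
have a0 k x e : 0 <= a k x e by apply: walk_ge0.
have p00 : 0 <= p by lra.
have mono F : (forall e, 0 <= F e) -> monotone F -> monotone (fun e => F e `^ p).
  by move=> F0 mF e e' ee'; apply: ge0_ler_powR; rewrite ?nnegrE//; exact: mF.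
have og z : observable (n + m + `|z|) (fun e => g z e `^ p).
  by apply: observable_powR => //; apply: observable_walk; lia.
have oa k z : observable (n + k + `|z|) (fun e => a k z e `^ p).
  by apply: observable_powR => //; apply: observable_walk; lia.
have key z : annealed (fun e => g z e `^ p) * moment p m <= moment p (n + m).
  rewrite /moment -(annealed_shift z (oa m 0)).
  rewrite (_ : (fun e : env => a m 0 (fun y => e (y + z)) `^ p) =
    (fun e => a m z e `^ p)); last first.
    by apply/funext => e; rewrite /a -[in RHS](add0r z) walk_shift.
  apply: le_trans (annealed_harris (og z) (oa m z) _ _) _.
  - by apply: mono => //; apply: monotone_walk.
  - by apply: mono => //; apply: monotone_walk.
  apply: le_mean => [||w].
  - exact: observable_bmeas (observableM (og z) (oa m z)).
  - exact: observable_bmeas (oa _ 0).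
  rewrite -powRM// ge0_ler_powR ?nnegrE ?mulr_ge0//; first exact: a0.
  rewrite /g mulrC -walkZ walkD; apply: le_walk => // y; rewrite /delta.
  have [->|_] := eqVneq y z; first by rewrite mulr1.
  by rewrite mulr0; exact: a0.
have sum_g e : a n 0 e <= \sum_(z <- box n) g z e.
  rewrite /a (@eq_walk _ b rr ll n e e (fun=> 1) (fun y => \sum_(z <- box n) 1 * delta z y) 0).
    by rewrite walk_sum; apply: ler_sum => z _; rewrite mul1r.
  move=> y; rewrite subr0 => yn; split=> //.
  rewrite (bigD1_seq y) ?mem_box ?sites_uniq//= /delta eqxx mul1r big1 ?addr0// => z zy.
  by rewrite eq_sym (negbTE zy) mulr0.
have mn : moment p n <= (n + n).+1%:R `^ p * \sum_(z <- box n) annealed (fun e => g z e `^ p).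
  rewrite -mean_sum; last by move=> z; exact: observable_bmeas (og z).
  rewrite -meanZ; last by apply: bmeas_sum => z; exact: observable_bmeas (og z).
  apply: le_mean => [||w].
  - exact: observable_bmeas (oa _ 0).
  - by apply: bmeasZ; apply: bmeas_sum => z; exact: observable_bmeas (og z).
  rewrite -size_box; apply: le_trans (powR_sum_le _ _ _) => //.
  by apply: ge0_ler_powR; rewrite ?nnegrE ?sumr_ge0//; [exact: a0|exact: sum_g].
have m0 : 0 <= moment p m by apply: mean_ge0 => w; exact: powR_ge0.
apply: le_trans (ler_wpM2r m0 mn) _.
rewrite powRD ?powRr1 ?pnatr_eq0 ?implybT// -!mulrA ler_wpM2l ?powR_ge0//.
rewrite mulr_suml mulr_natl -size_box -iter_addr_0 -(count_predT (box n)) -big_const_seq.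
exact: ler_sum.
Qed.

End Moments.

Section GrowthRate.
Context {R : realType}.

Lemma bernoulli_ge (x : R) n : 1 < x -> 1 + n%:R * (x - 1) <= x ^+ n.
Proof.
move=> x1; elim: n => [|n ih]; first by rewrite expr0 mul0r addr0.
have n0 : 0 <= n%:R * ((x - 1) * (x - 1)) by rewrite !mulr_ge0// subr_ge0 ltW.
have : x * (1 + n%:R * (x - 1)) <= x * x ^+ n by rewrite ler_wpM2l//; lra.
by rewrite exprS -natr1; lra.
Qed.

Lemma expr_unbounded (x M : R) : 1 < x -> exists N, forall n, (N <= n)%N -> M <= x ^+ n.
Proof.
move=> x1; have h0 : 0 < x - 1 by lra.
exists (Num.trunc (M / (x - 1))).+1 => n Nn; apply: le_trans (bernoulli_ge n x1).
have : M / (x - 1) <= n%:R.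
  by apply: le_trans (ltW (truncnS_gt _)) _; rewrite ler_nat.
rewrite ler_pdivrMr//; lra.
Qed.

Lemma supermul_rate (f w : nat -> R) (d D : R) : 0 < d ->
  (forall n, 0 < w n) -> (forall n, d ^+ n <= f n) -> (forall n, f n <= w n * D ^+ n) ->
  (forall n m, f n * f m <= w n * f (n + m)%N) ->
  exists A, [/\ 0 < A, forall n, f n <= w n * A ^+ n &
    forall B, 0 < B < A -> exists N, forall n, (N <= n)%N -> B ^+ n <= f n].
Proof.
move=> d0 w0 df fD fsup.
have f0 n : 0 < f n by rewrite (lt_le_trans _ (df n))// exprn_gt0.
have D0 : 0 < D.
  have := lt_le_trans (f0 1%N) (fD 1%N).
  by rewrite expr1 pmulr_rgt0.
pose r n := (f n.+1 / w n.+1) `^ (n.+1%:R^-1).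
have r0 n : 0 < r n by rewrite powR_gt0// divr_gt0.
have rE n : r n ^+ n.+1 = f n.+1 / w n.+1.
  by rewrite -powR_mulrn ?powR_ge0// -powRrM mulVf// powRr1// ltW// divr_gt0.
have rD n : r n <= D.
  rewrite -(@ler_pXn2r _ n.+1)// ?nnegrE ?(ltW D0) ?(ltW (r0 n))// rE.
  by rewrite ler_pdivrMr// mulrC.
pose S := [set r n | n in setT].
have supS : has_sup S by split; [exists (r 0%N); exists 0%N|exists D => _ [n _ <-]].
have rA n : r n <= sup S by apply: ub_le_sup => //; [exact: supS.2|exists n].
have A0 : 0 < sup S by exact: lt_le_trans (r0 0%N) (rA 0%N).
exists (sup S); split => // [n|B /andP[B0 BA]].
  case: n => [|n]; first by rewrite expr0; have := fD 0%N; rewrite expr0.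
  by rewrite mulrC -ler_pdivrMr// -rE ler_pXn2r// nnegrE ?(ltW A0) ?(ltW (r0 n)).
have SB0 : 0 < sup S - B by rewrite subr_gt0.
have [_ [n _ <-] Br] := sup_adherent SB0 supS.
rewrite subKr in Br.
have iter q m : (r n ^+ n.+1) ^+ q * f m <= f (q * n.+1 + m)%N.
  elim: q => [|q ih]; first by rewrite expr0 mul1r.
  rewrite exprS -mulrA mulSn -addnA.
  apply: le_trans (_ : r n ^+ n.+1 * f (q * n.+1 + m)%N <= _).
    by rewrite ler_wpM2l// rE ltW// divr_gt0.
  by rewrite rE mulrAC ler_pdivrMr// [_ * w _]mulrC.
pose d1 := Num.min 1 d; pose B1 := Num.max 1 B.
have d10 : 0 < d1 by rewrite lt_min ltr01.
have rB1 : 1 < r n / B by rewrite ltr_pdivlMr ?mul1r.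
have [N HN] := expr_unbounded (B1 ^+ n.+1 / d1 ^+ n.+1) rB1.
exists (N.+1 * n.+1)%N => k kN.
rewrite (divn_eq k n.+1); set q := (k %/ n.+1)%N; set m := (k %% n.+1)%N.
have mn : (m < n.+1)%N by rewrite ltn_mod.
have qN : (N <= q)%N by rewrite (@leq_trans N.+1)// leq_divRL.
apply: le_trans (iter q m); rewrite exprD -exprM [(n.+1 * q)%N]mulnC.
have qN' : (N <= q * n.+1)%N by rewrite (leq_trans qN)// leq_pmulr.
have Bm : B ^+ m <= B1 ^+ n.+1.
  apply: le_trans (_ : B1 ^+ m <= _).
    by rewrite lerXn2r ?nnegrE ?le_max ?ler01 ?lexx ?orbT// ltW.
  by apply: ler_weXn2l; rewrite ?le_max ?lexx// ltnW.
have fm : d1 ^+ n.+1 <= f m.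
  apply: le_trans (df m); apply: le_trans (_ : d1 ^+ m <= _).
    by apply: ler_wiXn2l; rewrite ?ge_min ?lexx ?(ltW d10)// ltnW.
  by rewrite lerXn2r ?nnegrE ?ge_min ?lexx ?orbT// ltW.
apply: le_trans (_ : B ^+ (q * n.+1) * B1 ^+ n.+1 <= _).
  by rewrite ler_wpM2l// exprn_ge0// ltW.
apply: le_trans (_ : r n ^+ (q * n.+1) * d1 ^+ n.+1 <= _); last first.
  by rewrite ler_wpM2l// exprn_ge0// ltW.
have := HN _ qN'; rewrite expr_div_n ler_pdivrMr ?exprn_gt0//.
by rewrite mulrAC ler_pdivlMr ?exprn_gt0// [X in _ -> X <= _]mulrC.
Qed.

End GrowthRate.

(** * Decay of the first moment *)

Lemma subz_succ (M : int) d : M - d.+1%:Z = M - d%:Z - 1.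
Proof. lia. Qed.

Lemma subz_succK (M : int) d : M - d.+1%:Z + 1 = M - d%:Z.
Proof. lia. Qed.

Lemma min_pos {R : realType} (x y : R) : 0 < x -> 0 < y ->
  exists z, [/\ 0 < z, z <= x & z <= y].
Proof.
by move=> x0 y0; exists (Num.min x y); rewrite lt_min x0 y0 !ge_min !lexx orbT.
Qed.

(* [theta] is the annealed growth rate of the walk, [g ^+ d] weighs the distance
   [d] to its running maximum and [K] is the price of a visited maximum relative
   to a fresh one, at which the first stay pays only [mu] instead of [s]. *)
Lemma drift_constants {R : realType} (r l s mu : R) :
  0 <= l -> l < r -> 0 < s -> 0 <= mu < s ->
  exists g K theta : R,
  [/\ 1 <= g /\ 1 <= K, 0 < theta < r + l + s,
      r + l * g ^+ 2 + s * g <= theta * g,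
      r + K * (l * g + s) <= theta * K &
      r + K * (l * g + mu) <= theta].
Proof.
move=> l0 lr s0 /andP[mu0 mus].
have [e1 [e10 e1h e1D]] : exists z, [/\ 0 < z, z <= 2^-1 :> R & z <= (s - mu) / (2 * (l + s))].
  by apply: min_pos; rewrite ?divr_gt0//; lra.
have e1D' : (l + s) * e1 <= (s - mu) / 2.
  move: e1D; rewrite ler_pdivlMr; lra.
have [m [m0 mr mD]] : exists z, [/\ 0 < z, z <= r * e1 / 2 & z <= (s - mu) / 4].
  by apply: min_pos; rewrite ?divr_gt0// ?mulr_gt0//; lra.
have [e' [e'0 e'1 e'm]] : exists z, [/\ 0 < z, z <= 1 & z <= m / (l + 1)].
  by apply: min_pos; rewrite ?divr_gt0//; lra.
have [e [e0 ee' er]] : exists z, [/\ 0 < z, z <= e' & z <= (r - l) / (2 * (l + 1))].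
  by apply: min_pos; rewrite ?divr_gt0//; lra.
have le : l * e <= m.
  have : e <= m / (l + 1) by exact: le_trans ee' e'm.
  rewrite ler_pdivlMr; lra.
have rle : l * e <= (r - l) / 2.
  move: er; rewrite ler_pdivlMr; lra.
have er0 : 0 < e * (r - l) by rewrite mulr_gt0//; lra.
have [h' [h'0 h'm h'e]] : exists z, [/\ 0 < z, z <= m & z <= e * (r - l) / 4].
  by apply: min_pos => //; lra.
have [h [h0 hh' ht]] : exists z, [/\ 0 < z, z <= h' & z <= (r + l + s) / 2].
  by apply: min_pos => //; lra.
have x0 : 0 < 1 - e1 by lra.
exists (1 + e), (1 - e1)^-1, (r + l + s - h); split.
- split; first lra.
  by rewrite -[1]invr1 lef_pV2 ?posrE//; lra.
- by apply/andP; split; lra.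
- have : h * e <= h by rewrite ler_piMr//; lra.
  have : e * (l * e) <= e * ((r - l) / 2) by rewrite ler_wpM2l// ltW.
  rewrite expr2; lra.
- rewrite -(ler_pM2r x0) mulrDl [X in _ + X](_ : _ = l * (1 + e) + s).
    by rewrite divfK ?gt_eqF//; lra.
  by rewrite mulrAC mulVf ?gt_eqF// mul1r.
- rewrite -(ler_pM2r x0) mulrDl [X in _ + X](_ : _ = l * (1 + e) + mu).
    have : 0 <= h * e1 by rewrite mulr_ge0 ?ltW.
    lra.
  by rewrite mulrAC mulVf ?gt_eqF// mul1r.
Qed.

Section AnnealedDecay.
Context {R : realType}.
Variables (b : R) (eta : probability (measurableTypeR R) R) (rr ll : R).
Hypotheses (b_lt0 : b < 0) (ll_ge0 : 0 <= ll) (ll_lt_rr : ll < rr).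
Local Notation env := (int -> R).
Implicit Types (e : env) (n k : nat) (M : int).

Definition mean_weight : R := mean eta (fun y => clamp b y - b).

Hypothesis mean_weight_lt : mean_weight < - b.

Lemma bmeas_weight : bmeas (fun y : measurableTypeR R => clamp b y - b : R).
Proof.
have := blip_upd (fun=> 0) 0 (blip_clamp b_lt0 0).
by rewrite /upd eqxx.
Qed.

Lemma mean_weight_ge0 : 0 <= mean_weight.
Proof. by apply: mean_ge0 => y; exact: (weight_ge0 b_lt0 (fun=> y) 0). Qed.

Let rr_gt0 : 0 < rr. Proof. exact: le_lt_trans ll_ge0 ll_lt_rr. Qed.

Lemma annealed_decay_aux g K theta :
  1 <= g -> 1 <= K -> 0 < theta ->
  rr + ll * g ^+ 2 + - b * g <= theta * g ->
  rr + K * (ll * g - b) <= theta * K ->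
  rr + K * (ll * g + mean_weight) <= theta ->
  forall n,
  (forall M k d e, (n <= k)%N ->
    savg eta (sites M k) (fun e => walk b rr ll n e (fun=> 1) (M - d%:Z)) e
      <= K * theta ^+ n * g ^+ d) /\
  (forall M k e, (n <= k)%N ->
    savg eta (sites M k) (fun e => walk b rr ll n e (fun=> 1) (M + 1)) e
      <= theta ^+ n).
Proof.
move=> g1 K1 th0 H1 H2 H3; have g0 : 0 < g by lra. have K0 : 0 < K by lra.
have r0 := rr_gt0; have l0 := ll_ge0; have b0 := b_lt0.
pose a n x e := walk b rr ll n e (fun=> 1) x.
have ba n x : blip (a n x) by exact: (blip_walk _ _ b0).
have bZ (k : R) n x : blip (fun e => k * a n x e) by exact: blipM (blip_cst k) (ba n x).
have bZ2 (k : R) n x (k' : R) n' x' : blip (fun e => k * a n x e + k' * a n' x' e).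
  exact: blipD (bZ _ _ _) (bZ _ _ _).
have bZ3 (k : R) n x (k' : R) n' x' (k'' : R) n'' x'' :
  blip (fun e => k * a n x e + k' * a n' x' e + k'' * a n'' x'' e).
  exact: blipD (bZ2 _ _ _ _ _ _) (bZ _ _ _).
have a0 n x e : 0 <= a n x e by apply: walk_ge0.
elim=> [|n [ihp ihf]]; split.
- move=> M k d e _; rewrite savg_cst expr0 mulr1; have : 1 <= g ^+ d by exact: exprn_ege1. nra.
- by move=> M k e _; rewrite savg_cst expr0.
- move=> M k d e nk; have tn : 0 < theta ^+ n by exact: exprn_gt0.
  have up : savg eta (sites M k) (a n.+1 (M - d%:Z)) e <=
     rr * savg eta (sites M k) (a n (M - d%:Z + 1)) e +
     ll * savg eta (sites M k) (a n (M - d%:Z - 1)) e +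
     (- b) * savg eta (sites M k) (a n (M - d%:Z)) e.
    rewrite -!savgZ// -!savgD//; try exact: bZ2.
    apply: le_savg => [||e']; [exact: ba|exact: bZ3|].
    rewrite /a walkS /step lerD2l ler_wpM2r//; first exact: a0.
    by have /andP[] := clamp_itv b0 (e' (M - d%:Z)); lra.
  apply: le_trans up _.
  have nk' : (n <= k)%N by exact: ltnW.
  have s0 := ihp M k d e nk'; have sl := ihp M k d.+1 e nk'.
  rewrite subz_succ in sl.
  have sf := ihf M k e nk'.
  case: d => [|d] in s0 sl *.
    rewrite subr0 in s0 sl *; rewrite expr0 mulr1 in s0 *; rewrite expr1 in sl.
    have := ler_wpM2l (ltW r0) sf; have := ler_wpM2l l0 sl.
    have := ler_wpM2l (ltW (ltac:(lra) : 0 < - b)) s0.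
    have := ler_wpM2r (ltW tn) H2; rewrite exprS /a; lra.
  have sr := ihp M k d e nk'.
  rewrite -subz_succK in sr.
  have gd : 0 < K * theta ^+ n * g ^+ d by rewrite !mulr_gt0// exprn_gt0.
  have := ler_wpM2l (ltW r0) sr; have := ler_wpM2l l0 sl.
  have := ler_wpM2l (ltW (ltac:(lra) : 0 < - b)) s0.
  have := ler_wpM2r (ltW gd) H1; rewrite [theta ^+ n.+1]exprS ![g ^+ _.+1]exprS /a; lra.
- move=> M [//|k] e nk.
  have tn : 0 < theta ^+ n by exact: exprn_gt0.
  rewrite sitesS /=.
  have up y : savg eta (sites (M + 1) k) (a n.+1 (M + 1)) (upd e (M + 1) y) <=
     rr * theta ^+ n + ll * (K * theta ^+ n * g) + K * theta ^+ n * (clamp b y - b).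
    have -> : savg eta (sites (M + 1) k) (a n.+1 (M + 1)) (upd e (M + 1) y) =
       rr * savg eta (sites (M + 1) k) (a n (M + 1 + 1)) (upd e (M + 1) y) +
       ll * savg eta (sites (M + 1) k) (a n (M + 1 - 1)) (upd e (M + 1) y) +
       (clamp b y - b) * savg eta (sites (M + 1) k) (a n (M + 1)) (upd e (M + 1) y).
      have bc := blip_clamp b0 (M + 1).
      have -> : clamp b y - b = clamp b (upd e (M + 1) y (M + 1)) - b.
        by rewrite /upd eqxx.
      rewrite -(@savgM _ _ _ _ (fun e => clamp b (e (M + 1)) - b))//; last first.
        move=> e' x y'; rewrite mem_sites /upd => xM.
        by case: eqP xM => // <-; rewrite ltxx.
      rewrite -!savgZ// -!savgD//; try exact: bZ2.
      exact: blipM bc (ba _ _).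
    have sr := ihf (M + 1) k (upd e (M + 1) y) nk.
    have sl := ihp (M + 1) k 1%N (upd e (M + 1) y) nk; rewrite expr1 in sl.
    have s0 := ihp (M + 1) k 0%N (upd e (M + 1) y) nk; rewrite expr0 mulr1 subr0 in s0.
    have cy := weight_ge0 b0 (fun=> y) 0.
    have := ler_wpM2l (ltW r0) sr; have := ler_wpM2l l0 sl.
    have := ler_wpM2l cy s0; rewrite /a; lra.
  apply: le_trans (_ : mean eta (fun y => rr * theta ^+ n + ll * (K * theta ^+ n * g) +
    K * theta ^+ n * (clamp b y - b)) <= _).
    apply: le_mean => //; first by apply: blip_upd; apply: blip_savg; exact: (ba n.+1 (M + 1)).
    by apply: bmeasD; [exact: bmeas_cst|apply: bmeasZ; exact: bmeas_weight].
  rewrite meanD ?mean_cst ?meanZ; [|exact: bmeas_weight|exact: bmeas_cst|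
    apply: bmeasZ; exact: bmeas_weight].
  have := ler_wpM2r (ltW tn) H3; rewrite exprS -/mean_weight; lra.
Qed.

Lemma annealed_decay : exists C theta : R, 0 < theta < total_rate b rr ll /\
  forall n e, savg eta (box n) (fun e => walk b rr ll n e (fun=> 1) 0) e <= C * theta ^+ n.
Proof.
have mw : 0 <= mean_weight < - b by rewrite mean_weight_ge0 mean_weight_lt.
have s0 : 0 < - b by rewrite oppr_gt0.
have [g [K [theta [[g1 K1] /andP[th0 th1] H1 H2 H3]]]] :=
  drift_constants ll_ge0 ll_lt_rr s0 mw.

exists K, theta; split=> [|n e]; first by rewrite th0.
have [ih _] := annealed_decay_aux g1 K1 th0 H1 H2 H3 n.
rewrite /box -addSn sitesD savg_cat.
rewrite (_ : - n.+1%:Z + n.+1%:Z = 0); last by rewrite addNr.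
rewrite -[leRHS](savg_cst eta (sites (- n.+1%:Z) n.+1) _ e).
apply: le_savg => [||e']; [|exact: blip_cst|].
  by apply: blip_savg; exact: (blip_walk _ _ b_lt0).
by have := ih 0 n 0%N e' (leqnn n); rewrite expr0 mulr1 subr0.
Qed.

End AnnealedDecay.

Section MomentRates.
Context {d : measure_display} {T : measurableType d} {R : realType}.
Variables (P : probability T R) (b : R) (eta : probability (measurableTypeR R) R).
Variable xi : int -> {RV P >-> R}.
Hypotheses (b_lt0 : b < 0) (eta_supp : eta `[b, 0]%classic = 1%E).
Hypothesis xi_iid : iid_with_law eta xi.
Variables (rr ll : R).
Hypotheses (rr_gt0 : 0 < rr) (ll_ge0 : 0 <= ll).

Local Notation moment := (moment b xi rr ll).

Definition site_mass (k : R) : R := fine (eta `[- k, +oo[%classic).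

Lemma powR_exprn (x p : R) n : 0 <= x -> (x ^+ n) `^ p = (x `^ p) ^+ n.
Proof. by move=> x0; rewrite -powR_mulrn// -powRrM mulrC powRrM powR_mulrn ?powR_ge0. Qed.

Lemma bmeas_moment p n : 1 <= p ->
  bmeas (fun w => walk b rr ll n (xi^~ w) (fun=> 1) 0 `^ p).
Proof.
move=> p1; apply: (@observable_bmeas _ _ _ P xi n (fun e => walk b rr ll n e (fun=> 1) 0 `^ p)).
apply: observable_powR => //; first by move=> e; apply: walk_ge0.
by apply: observable_walk.
Qed.

Lemma moment_le p n : 1 <= p -> moment p n <= (total_rate b rr ll `^ p) ^+ n.
Proof.
move=> p1; rewrite -(mean_cst P (_ ^+ n)); apply: le_mean => [||w].
- exact: bmeas_moment.
- exact: bmeas_cst.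
rewrite -powR_exprn; last by rewrite ltW// total_rate_gt0.
apply: ge0_ler_powR; rewrite ?nnegrE ?exprn_ge0//.
- by rewrite (le_trans _ p1).
- exact: walk_ge0.
- by rewrite ltW// total_rate_gt0.
- exact: walk_le.
Qed.

Lemma moment_ge p n k : 1 <= p -> 0 <= k <= - b ->
  site_mass k ^+ (n + n).+1 * ((total_rate b rr ll - k) `^ p) ^+ n <= moment p n.
Proof.
move=> p1 k0b; have /andP[k0 kb] := k0b.
have tk : 0 <= total_rate b rr ll - k.
  by rewrite /total_rate; move: rr_gt0 ll_ge0 => ? ?; lra.
pose A (x : int) : set R := `[- k, +oo[%classic.
have mA x : measurable (A x) by exact: measurable_itv.
pose v := ((total_rate b rr ll - k) ^+ n) `^ p.
have -> : site_mass k ^+ (n + n).+1 = mean P (fun w => \prod_(z <- box n) \1_(A z) (xi z w)).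
  rewrite (mean_prod_indic xi_iid) ?sites_uniq// (eq_bigr (fun=> site_mass k))//.
  rewrite big_const_seq count_predT size_box.
  by rewrite iter_mulr_1.
have bi : bmeas (fun w => \prod_(z <- box n) \1_(A z) (xi z w) : R).
  by apply: bmeas_prod => z; exact: bmeas_indic_xi.
rewrite -powR_exprn// -/v mulrC -meanZ//; apply: le_mean => [||w].
- exact: bmeasZ.
- exact: bmeas_moment.
have [H|/existsNP[z /not_implyP[zn Hz]]] :=
    pselect (forall z, z \in box n -> - k <= xi z w); last first.
  rewrite (big_rem z)//= indicE memNset ?mul0r ?mulr0 ?powR_ge0//.
  by rewrite /A /= in_itv/= andbT.
rewrite big_seq big1 ?mulr1; last first.
  by move=> z zn; rewrite indicE mem_set//= /A /= in_itv/= andbT H.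
apply: ge0_ler_powR; rewrite ?nnegrE ?exprn_ge0//.
- by rewrite (le_trans _ p1).
- exact: walk_ge0.
- apply: walk_ge => // y; rewrite subr0 => yn.
  by apply: H; rewrite mem_box.
Qed.

Lemma site_mass_supp : site_mass (- b) = 1.
Proof.
rewrite /site_mass opprK; have : (eta `[b, +oo[%classic = 1)%E.
  apply/eqP; rewrite eq_le; apply/andP; split; first exact: probability_le1.
  rewrite -eta_supp; apply: le_measure; rewrite ?inE; try exact: measurable_itv.
  by move=> y /=; rewrite !in_itv/= andbT => /andP[].
by move=> ->.
Qed.

Lemma moment_rate p : 1 <= p -> exists rho, [/\ 0 < rho,
  forall n, moment p n <= (n + n).+1%:R `^ (p + 1) * (rho `^ p) ^+ n &
  forall B, 0 < B < rho ->
    exists N, forall n, (N <= n)%N -> (B `^ p) ^+ n <= moment p n].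
Proof.
move=> p1; have p0 : 0 < p by lra.
pose w n : R := (n + n).+1%:R `^ (p + 1).
have w1 n : 1 <= w n.
  by rewrite -[leLHS](powRr0 (n + n).+1%:R); apply: ler_powR; [rewrite ler1n|lra].
have rl0 : 0 < rr + ll by rewrite ltr_pwDl.
have Hd n : ((rr + ll) `^ p) ^+ n <= moment p n.
  have := @moment_ge p n (- b) p1; rewrite lexx oppr_ge0 (ltW b_lt0) => /(_ isT).
  by rewrite site_mass_supp expr1n mul1r /total_rate opprK subrK.
have HD n : moment p n <= w n * (total_rate b rr ll `^ p) ^+ n.
  apply: le_trans (moment_le n p1) _; rewrite ler_peMl// exprn_ge0// powR_ge0//.
have [A [A0 AD AB]] := supermul_rate (powR_gt0 p rl0)
  (fun n => lt_le_trans ltr01 (w1 n)) Hd HD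
  (fun n m => moment_supermul b_lt0 eta_supp xi_iid rr_gt0 ll_ge0 n m p1).
exists (A `^ p^-1); have -> : (A `^ p^-1) `^ p = A.
  by rewrite -powRrM mulVf ?gt_eqF// powRr1// ltW.
split=> //; first exact: powR_gt0.
move=> B /andP[B0 BA]; apply: AB; rewrite powR_gt0//=.
rewrite -[ltRHS](powRr1 (ltW A0)) -(mulVf (lt0r_neq0 p0)) powRrM.
by apply: gt0_ltr_powR; rewrite // nnegrE ?powR_ge0// ltW.
Qed.

End MomentRates.

(** * Comparison of the solution with the polymer *)

Section TaylorComparison.
Context {R : realType}.
Implicit Types (f g : R -> R) (s t : R).

Lemma le_of_derive f g (f' g' : R -> R) t : 0 <= t ->
  {within `[0, t], continuous f} -> {within `[0, t], continuous g} ->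
  (forall s, s \in `]0, t[ -> is_derive s 1 f (f' s)) ->
  (forall s, s \in `]0, t[ -> is_derive s 1 g (g' s)) ->
  f 0 <= g 0 -> (forall s, s \in `]0, t[ -> f' s <= g' s) -> f t <= g t.
Proof.
rewrite le_eqVlt => /predU1P[<- //|t0] cf cg df dg fg0 fg'.
have [s st] := @MVT R (g - f) (fun s => g' s - f' s) 0 t t0
  (fun s hs => is_deriveB (dg s hs) (df s hs))
  (fun x => continuousB (cg x) (cf x)).
rewrite /= subr0 !fctE => H; rewrite -subr_ge0.
have : 0 <= (g' s - f' s) * t by rewrite mulr_ge0 ?subr_ge0 ?fg'// ltW.
lra.
Qed.

Definition expterm (k : nat) t : R := t ^+ k / k`!%:R.

Definition exppoly (n : nat) (c : nat -> R) t : R := \sum_(k < n) c k * expterm k t.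

Lemma is_derive_expterm k t : is_derive t 1 (expterm k.+1) (expterm k t).
Proof.
have -> : expterm k.+1 = (k.+1`!%:R)^-1 \*: (@idfun R) ^+ k.+1.
  by apply/funext => s; rewrite /expterm /= mulrC; congr (_ * _); rewrite fctE.
apply: is_derive_eq (is_deriveZ _ (is_deriveX k.+1 (is_derive_id t 1))) _.
rewrite /expterm factS natrM /GRing.scale /= mulr1 invfM.
have k0 : k.+1%:R != 0 :> R by rewrite pnatr_eq0.
have f0 : k`!%:R != 0 :> R by rewrite pnatr_eq0 -lt0n fact_gt0.
by rewrite mulrACA mulVf// mul1r mulrC.
Qed.

Lemma exppolyS n c t : exppoly n.+1 c t = exppoly n c t + c n * expterm n t.
Proof. by rewrite /exppoly big_ord_recr. Qed.

Lemma is_derive_exppoly n (c : nat -> R) t :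
  is_derive t 1 (exppoly n.+1 c) (exppoly n (fun k => c k.+1) t).
Proof.
elim: n => [|n ih].
  rewrite /exppoly big_ord0 (_ : (fun _ => _) = fun=> c 0%N); first exact: is_derive_cst.
  by apply/funext => s; rewrite big_ord1 /expterm expr0 divr1 mulr1.
rewrite exppolyS (_ : exppoly n.+2 c = exppoly n.+1 c + c n.+1 \*: expterm n.+1).
  by apply: is_deriveD; apply: is_deriveZ; exact: is_derive_expterm.
by apply/funext => s; rewrite exppolyS.
Qed.

Lemma continuous_exppoly n c : continuous (exppoly n c).
Proof.
move=> t; case: n => [|n].
  have -> : exppoly 0 c = fun=> 0 by apply/funext => s; rewrite /exppoly big_ord0.
  exact: cvg_cst.
apply: differentiable_continuous; apply/derivable1_diffP.
by have [] := is_derive_exppoly n c t.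
Qed.

Lemma exppoly0 n c : exppoly n.+1 c 0 = c 0%N.
Proof.
rewrite /exppoly big_ord_recl /= /expterm expr0 divr1 mulr1 big1 ?addr0// => i _.
by rewrite exprS !mul0r mulr0.
Qed.

End TaylorComparison.

Section PamSeries.
Context {R : realType}.
Variables (kappa h b : R) (e : int -> R) (u : R -> int -> R).
Hypotheses (kappa_gt0 : 0 < kappa) (h_gt0 : 0 < h) (h_le1 : h <= 1) (b_lt0 : b < 0).
Hypothesis e_itv : forall x, b <= e x <= 0.
Hypothesis u_sol : pam_solution kappa h e u.

Implicit Types (s t : R) (x : int) (n k : nat).

Let rr := kappa * (1 + h) / 2.
Let ll := kappa * (1 - h) / 2.
Let c := total_rate b rr ll.
Let v t x := expR (c * t) * u t x.
Let a k x := walk b rr ll k e (fun=> 1) x.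

Let rr_gt0 : 0 < rr.
Proof. by apply: divr_gt0 => //; apply: mulr_gt0 => //; move: h_gt0 => *; lra. Qed.

Let ll_ge0 : 0 <= ll.
Proof. by apply: divr_ge0 => //; apply: mulr_ge0; [exact: ltW|rewrite subr_ge0]. Qed.

Let c_gt0 : 0 < c.
Proof. exact: total_rate_gt0 b_lt0 rr_gt0 ll_ge0. Qed.

Let is_derive_v t x : 0 < t ->
  is_derive t 1 (v ^~ x) (step b rr ll e (v t) x).
Proof.
move=> t0; have du := pam_eq u_sol x t0.
have dc : is_derive t 1 (fun s : R => c * s) c.
  apply: is_derive_eq (is_deriveZ c (is_derive_id t 1)) _.
  by rewrite /GRing.scale /= mulr1.
have de := is_derive1_comp (is_derive_expR (c * t)) dc.
apply: is_derive_eq (is_deriveM de du) _.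
rewrite /step /v (clamp_id (e_itv x)) /drift_laplacian /GRing.scale /= /c /total_rate /rr /ll.
by field.
Qed.

Let cont_v t x : {within `[0, t], continuous (v ^~ x)}.
Proof.
have cu : {within `[0, t], continuous (u ^~ x)}.
  have [_ cu _ _ _] := u_sol.
  apply: (@continuous_subspaceW _ _ _ _ (u ^~ x) _ (cu x)).
  by move=> s /=; rewrite !in_itv/= => /andP[->].
move=> s; apply: (@continuousM _ (subspace `[0, t]) (fun s => expR (c * s)) (u ^~ x)).
  apply: continuous_subspaceT => r.
  apply: (@continuous_comp _ _ _ (fun s : R => c * s) expR); last exact: continuous_expR.
  exact: mulrl_continuous.
exact: cu.
Qed.

Let v0 x : v 0 x = 1.
Proof. by rewrite /v mulr0 expR0 mul1r (pam_init u_sol). Qed.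

Let v_ge0 t x : 0 <= t -> 0 <= v t x.
Proof. by move=> t0; rewrite mulr_ge0 ?expR_ge0// (pam_ge0 u_sol). Qed.

Let dv x t s : s \in `]0, t[ -> is_derive s 1 (v ^~ x) (step b rr ll e (v s) x).
Proof. by rewrite in_itv => /andP[s0 _]; exact: is_derive_v. Qed.

Lemma pam_lower n t x : 0 <= t ->
  expterm n t * a n x <= expR (c * t) * u t x.
Proof.
rewrite -/(v t x); elim: n t x => [|n ih] t x t0.
  rewrite /expterm expr0 divr1 mul1r /a.
  have c1 : {within `[0, t], continuous (fun=> 1 : R)}.
    by apply: continuous_subspaceT => s; exact: cvg_cst.
  apply: (@le_of_derive R (fun=> 1) (v ^~ x) (fun=> 0)
    (fun s => step b rr ll e (v s) x) t t0 c1 (@cont_v t x)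
    (fun s _ => is_derive_cst _ _ _) (@dv x t)) => [|s st].
  - by rewrite v0.
  - move: st; rewrite in_itv => /andP[s0 _]; have s0' := ltW s0.
    by rewrite /step !addr_ge0// mulr_ge0 ?(ltW rr_gt0) ?v_ge0// weight_ge0.
pose f s := a n.+1 x * expterm n.+1 s.
rewrite mulrC.
have cf : {within `[0, t], continuous f}.
  apply: continuous_subspaceT => s.
  apply: differentiable_continuous; apply/derivable1_diffP.
  by have [] := is_deriveZ (a n.+1 x) (is_derive_expterm n s).
apply: (@le_of_derive _ f (v ^~ x) (fun s => a n.+1 x * expterm n s)
    (fun s => step b rr ll e (v s) x) t t0 cf (@cont_v t x)
    (fun s _ => is_deriveZ (a n.+1 x) (is_derive_expterm n s)) (@dv x t)) => [|s st].
  by rewrite /f /expterm expr0n mul0r mulr0 v0.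
move: st; rewrite in_itv => /andP[s0 _]; have s0' := ltW s0.
rewrite /a walkS mulrC.
rewrite /step !mulrDr !(mulrCA (expterm n s)) !lerD//.
- by rewrite ler_wpM2l ?(ltW rr_gt0)// ih.
- by rewrite ler_wpM2l// ih.
- by rewrite ler_wpM2l ?weight_ge0// ih.
Qed.

Let pam_upper_aux K t : (forall s x, 0 <= s <= t -> v s x <= K) ->
  forall n s x, 0 <= s <= t ->
  v s x <= exppoly n.+1 (fun k => if (k < n)%N then a k x else K * c ^+ n) s.
Proof.
move=> vK; elim=> [|n ih] s x st.
  by rewrite /exppoly big_ord1 /= /expterm !expr0 divr1 !mulr1 vK.
have /andP[s0 st'] := st.
set co := fun k => _.
have cco : {within `[0, s], continuous (exppoly n.+2 co)}.
  by apply: continuous_subspaceT => r; exact: continuous_exppoly.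
apply: (@le_of_derive _ (v ^~ x) (exppoly n.+2 co) (fun s => step b rr ll e (v s) x)
    (exppoly n.+1 (fun k => co k.+1)) s s0 (@cont_v s x) cco
    (@dv x s) (fun r _ => is_derive_exppoly n.+1 co r)) => [|r rs].
  by rewrite v0 exppoly0 /co.
move: rs; rewrite in_itv => /andP[r0 rs].
have r0' := ltW r0.
have rt : 0 <= r <= t by rewrite r0' (le_trans (ltW rs)).
pose K' x' k := if (k < n)%N then a k x' else K * c ^+ n.
apply: le_trans (_ : step b rr ll e (fun x' => exppoly n.+1 (K' x') r) x <= _).
  rewrite /step !lerD//.
  - by rewrite ler_wpM2l ?(ltW rr_gt0)// ih.
  - by rewrite ler_wpM2l// ih.
  - by rewrite ler_wpM2l ?weight_ge0// ih.
rewrite /step /exppoly !mulr_sumr -!big_split /=; apply: ler_sum => k _.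
have ek : 0 <= expterm k r by rewrite /expterm divr_ge0// exprn_ge0.
move: (expterm k r) ek => E E0.
rewrite !mulrA -!mulrDl ler_wpM2r// /co /K' ltnS; case: ifP => // _.
have K0 : 0 <= K * c ^+ n.
  rewrite mulr_ge0 ?exprn_ge0 ?(ltW c_gt0)//.
  by apply: le_trans (vK r x rt); exact: v_ge0.
have /andP[c1 c2] := clamp_itv b_lt0 (e x).
rewrite -!mulrDl exprS [leRHS]mulrCA ler_wpM2r// /c /total_rate /rr /ll; lra.
Qed.

Lemma pam_upper t x eps : 0 <= t -> 0 < eps ->
  exists n, expR (c * t) * u t x <= exppoly n (a ^~ x) t + eps.
Proof.
move=> t0 eps0; have [M uM] := pam_bounded u_sol.
have M0 : 0 <= M := le_trans (pam_ge0 u_sol 0 (lexx _)) (uM _ 0 (lexx _)).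
pose K := expR (c * t) * M.
have vK s y : 0 <= s <= t -> v s y <= K.
  move=> /andP[s0 st]; rewrite /v /K ler_pM ?expR_ge0 ?(pam_ge0 u_sol)//.
    by rewrite ler_expR ler_wpM2l// ltW.
  exact: uM.
have [n Hn] : exists n, K * (expterm n (c * t)) <= eps.
  have K1 : 0 < K + 1 by rewrite ltr_wpDl// mulr_ge0 ?expR_ge0.
  have : \forall n \near \oo, `|0 - exp_coeff (c * t) n| <= eps / (K + 1).
    by move/cvgrPdist_le: (cvg_exp_coeff (c * t)); apply; rewrite divr_gt0.
  move=> [n _ /(_ n (leqnn n))] /=; rewrite sub0r normrN.
  have e0 : 0 <= expterm n (c * t) by rewrite divr_ge0// exprn_ge0// mulr_ge0// ltW.
  rewrite ger0_norm// ler_pdivlMr// => Hn; exists n.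
  by apply: le_trans Hn; rewrite mulrC ler_wpM2l// lerDl.
exists n; rewrite -/(v t x).
apply: le_trans (pam_upper_aux vK n x _) _; first by rewrite t0 lexx.
rewrite exppolyS ltnn; apply: lerD; last first.
  by apply: le_trans Hn; rewrite /expterm exprMn !mulrA.
by rewrite /exppoly le_eqVlt; apply/orP; left; apply/eqP; apply: eq_bigr => k _; rewrite ltn_ord.
Qed.

End PamSeries.

(* The solution is prescribed only almost surely, so the integrands of its moments
   need not be measurable; the integral of a nonnegative function is then still
   the supremum over its simple minorants. *)
Section NonmeasurableIntegrands.
Local Open Scope ereal_scope.
Context {d : measure_display} {T : measurableType d} {R : realType}.
Variable mu : {measure set T -> \bar R}.
Implicit Types f g : T -> \bar R.

Import HBNNSimple.

Lemma ge0_le_integral_nomeas f g : (forall x, 0 <= f x) -> (forall x, f x <= g x) ->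
  \int[mu]_x f x <= \int[mu]_x g x.
Proof.
move=> f0 fg; have g0 x : 0 <= g x by exact: le_trans (f0 x) (fg x).
rewrite !ge0_integralTE//; apply: le_ereal_sup => _ [h /= hf <-].
by exists h => //= x; exact: le_trans (hf x) (fg x).
Qed.

Lemma ae_le_integral_lower f g : measurable_fun setT f -> (forall x, 0 <= f x) ->
  (forall x, 0 <= g x) -> {ae mu, forall x, f x <= g x} ->
  \int[mu]_x f x <= \int[mu]_x g x.
Proof.
move=> mf f0 g0 [N [mN N0 fgN]].
rewrite (ge0_negligible_integral mN _ _ _ N0)// integral_mkcond.
apply: ge0_le_integral_nomeas => x; rewrite patchE; case: ifPn => // xN.
apply: contrapT => fg; have : N x by apply: fgN.
by move: xN; rewrite inE => -[].
Qed.

Lemma ae_le_integral_upper f g : measurable_fun setT g -> (forall x, 0 <= f x) ->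
  (forall x, 0 <= g x) -> {ae mu, forall x, f x <= g x} ->
  \int[mu]_x f x <= \int[mu]_x g x.
Proof.
move=> mg f0 g0 [N [mN N0 fgN]].
rewrite [leLHS]ge0_integralTE//; apply: ge_ereal_sup => _ [h /= hf <-].
have <- : \int[mu]_x (h x)%:E = sintegral mu h by rewrite integral_nnsfun// patch_setT.
apply: ae_le_integral_lower => //.
- by apply/measurable_EFinP.
- by move=> x; rewrite lee_fin.
exists N; split=> // x /= fg; apply: fgN => /= fg'; apply: fg.
exact: le_trans (hf x) fg'.
Qed.

End NonmeasurableIntegrands.

Section Series.
Context {R : realType}.

Lemma exp_partial_le (x : R) n : 0 <= x -> \sum_(k < n) expterm k x <= expR x.
Proof.
move=> x0; rewrite -(big_mkord xpredT (fun k => expterm k x)).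
apply: (nondecreasing_cvgn_le (u_ := series (exp_coeff x))).
  apply/nondecreasing_seqP => k; rewrite /series /= big_nat_recr//= lerDl.
  exact: exp_coeff_ge0.
exact: is_cvg_series_exp_coeff.
Qed.

Lemma geometric_partial_le (q : R) n : 0 <= q < 1 -> \sum_(k < n) q ^+ k <= (1 - q)^-1.
Proof.
move=> /andP[q0 q1]; have q1' : 0 < 1 - q by rewrite subr_gt0.
rewrite -[(1 - q)^-1]mul1r ler_pdivlMr// mulrC.
have := subrX1 q n; rewrite -[1 - q]opprB mulNr => <-.
by rewrite opprB lerBlDr lerDl exprn_ge0.
Qed.

Lemma poly_le_geometric (s x : R) : 0 < s -> 1 < x ->
  exists2 C, 0 < C & forall n, (n + n).+1%:R `^ s <= C * x ^+ n.
Proof.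
move=> s0 x1; pose y := x `^ s^-1.
have y1 : 1 < y.
  rewrite /y /powR gt_eqF ?(lt_trans ltr01)// -[ltLHS]expR0 ltr_expR.
  by rewrite mulr_gt0 ?invr_gt0 ?ln_gt0.
have y10 : 0 < y - 1 by rewrite subr_gt0.
pose K := 2 / (y - 1) + 1.
have K0 : 0 < K by rewrite ltr_wpDl// divr_ge0// ltW.
exists (K `^ s) => [|n]; first exact: powR_gt0.
have xy : x ^+ n = (y ^+ n) `^ s.
  rewrite -!powR_mulrn ?powR_ge0 ?(le_trans ler01 (ltW x1))// /y -!powRrM.
  by congr powR; field; rewrite gt_eqF.
rewrite xy -powRM ?(ltW K0) ?exprn_ge0 ?powR_ge0//.
apply: ge0_ler_powR; rewrite ?nnegrE ?(ltW s0) ?mulr_ge0 ?(ltW K0) ?exprn_ge0 ?powR_ge0//.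
apply: le_trans (_ : K * (1 + n%:R * (y - 1)) <= _); last first.
  by rewrite ler_wpM2l ?(ltW K0)// bernoulli_ge.
have n0 : 0 <= n%:R :> R by [].
have -> : K * (1 + n%:R * (y - 1)) = 2 / (y - 1) + 1 + (2 * n%:R + n%:R * (y - 1)).
  by rewrite /K; field; rewrite gt_eqF.
have : 0 <= 2 / (y - 1) by rewrite divr_ge0// ltW.
have : 0 <= n%:R * (y - 1) by rewrite mulr_ge0// ltW.
rewrite -[(n + n).+1%:R]natr1 natrD; lra.
Qed.

End Series.

Section SolutionMoments.
Context {d : measure_display} {T : measurableType d} {R : realType}.
Variables (P : probability T R) (kappa h b : R).
Variables (eta : probability (measurableTypeR R) R).
Variables (xi : int -> {RV P >-> R}) (u : T -> R -> int -> R).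
Hypotheses (kappa_gt0 : 0 < kappa) (h_gt0 : 0 < h) (h_le1 : h <= 1) (b_lt0 : b < 0).
Hypothesis eta_supp : eta `[b, 0]%classic = 1%E.
Hypothesis xi_iid : iid_with_law eta xi.
Hypothesis u_solution :
  \forall w \ae P, pam_solution kappa h (fun x => xi x w) (u w).

Definition rright : R := kappa * (1 + h) / 2.
Definition rleft : R := kappa * (1 - h) / 2.

Local Notation c := (total_rate b rright rleft).
Local Notation moment := (moment b xi rright rleft).
Local Notation walk0 k w := (walk b rright rleft k (xi^~ w) (fun=> 1) 0).

Lemma rright_gt0 : 0 < rright.
Proof. by apply: divr_gt0 => //; apply: mulr_gt0 => //; move: h_gt0 => *; lra. Qed.

Lemma rleft_ge0 : 0 <= rleft.
Proof. by apply: divr_ge0 => //; apply: mulr_ge0; [exact: ltW|rewrite subr_ge0]. Qed.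

Lemma mean_EFin (f : T -> R) : bmeas f -> (mean P f)%:E = (\int[P]_w (f w)%:E)%E.
Proof.
move=> bf; rewrite /mean /Rintegral fineK//.
by apply: integrable_fin_num => //; exact: bmeas_integrable.
Qed.

Lemma ae_int (Q : int -> T -> Prop) : (forall x, \forall w \ae P, Q x w) ->
  \forall w \ae P, forall x, Q x w.
Proof.
move=> HQ; have : \forall w \ae P, forall n : nat, Q n%:Z w /\ Q (- n%:Z) w.
  apply: ae_foralln => n; apply: filterS2 (HQ n%:Z) (HQ (- n%:Z)) => w *; exact: conj.
apply: filterS => w H [n|n]; first by have [] := H n.
by rewrite NegzE; have [] := H n.+1.
Qed.

Lemma solution_ae : \forall w \ae P, (forall x, b <= xi x w <= 0) /\
  pam_solution kappa h (fun x => xi x w) (u w).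
Proof.
apply: filterS2 u_solution (ae_int (xi_supp eta_supp xi_iid)) => w ? ?; exact: conj.
Qed.

Lemma expectation_lower p t n : 1 <= p -> 0 <= t ->
  (((expR (- (c * t)) * expterm n t) `^ p * moment p n)%:E
    <= 'E_P[fun w => (u w t 0 `^ p)%R])%E.
Proof.
move=> p1 t0; rewrite unlock; have p0 : 0 <= p by rewrite (le_trans _ p1).
have e0 : 0 <= expterm n t by rewrite divr_ge0// exprn_ge0.
have bw := bmeas_moment xi b_lt0 rright_gt0 rleft_ge0 n p1.
rewrite /moment /annealed -meanZ// mean_EFin; last exact: bmeasZ.
apply: ae_le_integral_lower.
- by apply/measurable_EFinP; have [] := bmeasZ ((expR (- (c * t)) * expterm n t) `^ p) bw.
- by move=> w; rewrite lee_fin mulr_ge0 ?powR_ge0.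
- by move=> w; rewrite lee_fin powR_ge0.
apply: filterS solution_ae => w [xib sol].
have w0 : 0 <= walk0 n w by apply: walk_ge0; [|exact: rright_gt0|exact: rleft_ge0|].
rewrite lee_fin -powRM//; last by rewrite mulr_ge0 ?expR_ge0.
apply: ge0_ler_powR; rewrite ?nnegrE//.
- by rewrite mulr_ge0// mulr_ge0// expR_ge0.
- exact: (pam_ge0 sol 0 t0).
have H : expterm n t * walk0 n w <= expR (c * t) * u w t 0 :=
  pam_lower kappa_gt0 h_gt0 h_le1 b_lt0 xib sol n 0 t0.
by rewrite -mulrA expRN ler_pdivrMl ?expR_gt0.
Qed.

Lemma solution_upper p t B w : 1 <= p -> 0 <= t -> 0 < B ->
  (forall x, b <= xi x w <= 0) -> pam_solution kappa h (fun x => xi x w) (u w) ->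
  exists n, u w t 0 `^ p <= (2 * expR ((B - c) * t)) `^ p *
    \sum_(k < n) (walk0 k w `^ p / (B `^ p) ^+ k).
Proof.
move=> p1 t0 B0 xib sol; have p0 : 0 < p by rewrite (lt_le_trans _ p1).
have w0 k : 0 <= walk0 k w by apply: walk_ge0; [|exact: rright_gt0|exact: rleft_ge0|].
have [n Hn] := pam_upper kappa_gt0 h_gt0 h_le1 b_lt0 xib sol 0 t0 (expR_gt0 (B * t)).
exists n.+1; set z := \sum_(k < n.+1) _.
have zk0 k : 0 <= walk0 k w `^ p / (B `^ p) ^+ k.
  by rewrite divr_ge0 ?powR_ge0// exprn_ge0// powR_ge0.
have z0 : 0 <= z by rewrite sumr_ge0.
have z1 : 1 <= z.
  apply: le_trans (_ : walk0 0 w `^ p / (B `^ p) ^+ 0 <= _).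
    by rewrite /walk /= powR1 expr0 divr1.
  by rewrite /z (bigD1 ord0)// lerDl; apply: sumr_ge0 => i _; exact: zk0.
have zp1 : 1 <= z `^ p^-1.
  by rewrite -[leLHS](powRr0 z); apply: ler_powR; rewrite ?invr_ge0 ?(ltW p0).
have zk k : (k < n.+1)%N -> walk0 k w <= z `^ p^-1 * B ^+ k.
  move=> kn; have : walk0 k w `^ p / (B `^ p) ^+ k <= z.
    by rewrite /z (bigD1 (Ordinal kn))//= lerDl sumr_ge0.
  rewrite ler_pdivrMr ?exprn_gt0 ?powR_gt0// -powR_exprn ?(ltW B0)// => H.
  have -> : walk0 k w = (walk0 k w `^ p) `^ p^-1.
    by rewrite -powRrM mulfV ?lt0r_neq0// powRr1.
  apply: le_trans (_ : (z * (B ^+ k) `^ p) `^ p^-1 <= _).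
    apply: ge0_ler_powR => //.
    - by rewrite invr_ge0 ltW.
    - by rewrite nnegrE powR_ge0.
    - by rewrite nnegrE mulr_ge0// powR_ge0.
  rewrite powRM ?powR_ge0// -powRrM mulfV ?lt0r_neq0// powRr1// exprn_ge0// ltW//.
have sum_le : exppoly n (fun k => walk0 k w) t <= z `^ p^-1 * expR (B * t).
  apply: le_trans (_ : z `^ p^-1 * \sum_(k < n) expterm k (B * t) <= _).
    rewrite mulr_sumr; apply: ler_sum => k _.
    rewrite /expterm exprMn !mulrA ler_wpM2r// ler_wpM2r ?exprn_ge0// zk// ltnW//.
    by rewrite ltnS ltn_ord.
  by rewrite ler_wpM2l ?powR_ge0// exp_partial_le// mulr_ge0// ltW.
have uz : u w t 0 <= 2 * expR ((B - c) * t) * z `^ p^-1.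
  have : expR (c * t) * u w t 0 <= 2 * expR (B * t) * z `^ p^-1.
    apply: le_trans Hn _.
    have := @expR_gt0 _ (B * t).
    move: sum_le zp1; rewrite /rright /rleft; nra.
  rewrite -ler_pdivlMl ?expR_gt0// => /le_trans; apply.
  rewrite -expRN (_ : (B - c) * t = - (c * t) + B * t); last by ring.
  rewrite expRD; lra.
apply: le_trans (_ : (2 * expR ((B - c) * t) * z `^ p^-1) `^ p <= _).
  apply: ge0_ler_powR; rewrite ?nnegrE ?(ltW p0) ?(pam_ge0 sol 0 t0)//.
  by rewrite !mulr_ge0 ?expR_ge0 ?powR_ge0.
rewrite powRM ?powR_ge0 ?mulr_ge0 ?expR_ge0//.
by rewrite -powRrM mulVf ?lt0r_neq0// powRr1.
Qed.

End SolutionMoments.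

Section FactorialBound.
Context {R : realType}.

Lemma fact_le_pow n : (0 < n)%N -> n`!%:R * expR (n%:R - 1) <= n%:R ^+ n.+1 :> R.
Proof.
case: n => // n _; elim: n => [|n ih].
  by rewrite subrr expR0 expr1n mulr1 (_ : 1`! = 1%N).
have n0 : 0 < n.+2%:R :> R by [].
have key : n.+1%:R ^+ n.+2 * expR 1 <= n.+2%:R ^+ n.+2 :> R.
  have H : n.+1%:R <= n.+2%:R * expR (- n.+2%:R^-1) :> R.
    apply: le_trans (_ : n.+2%:R * (1 + - n.+2%:R^-1) <= _).
      by rewrite mulrDr mulr1 mulrN mulfV ?gt_eqF// -[n.+2%:R]natr1 addrK.
    by rewrite ler_wpM2l// expR_ge1Dx.
  have : n.+1%:R ^+ n.+2 <= (n.+2%:R * expR (- n.+2%:R^-1)) ^+ n.+2 :> R.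
    by rewrite lerXn2r// nnegrE// mulr_ge0 ?expR_ge0.
  rewrite exprMn -expRM_natl mulrN mulfV ?gt_eqF// => H2.
  apply: le_trans (ler_wpM2r (expR_ge0 1) H2) _.
  by rewrite -mulrA -expRD addNr expR0 mulr1.
rewrite factS natrM (_ : n.+2%:R - 1 = (n.+1%:R - 1) + 1 :> R); last first.
  by rewrite subrK -[n.+2%:R]natr1 addrK.
rewrite expRD exprS mulrA -(mulrA _ _ (expR (n.+1%:R - 1))) -mulrA ler_wpM2l//.
apply: le_trans key; rewrite ler_wpM2r ?expR_ge0//.
Qed.

Lemma expterm_ge (s : R) : 1 <= s -> expR (s - 2) / s <= expterm (Num.trunc s) s.
Proof.
move=> s1; have s0 : 0 < s by rewrite (lt_le_trans ltr01).
have /andP[ns sn] := truncn_itv (ltW s0); set n := Num.trunc s in ns sn *.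
have n0 : (0 < n)%N by rewrite /n truncn_gt0.
have n0' : 0 < n%:R :> R by rewrite ltr0n.
have f0 : 0 < n`!%:R :> R by rewrite ltr0n fact_gt0.
apply: le_trans (_ : n%:R ^+ n / n`!%:R <= _); last first.
  by rewrite ler_wpM2r ?invr_ge0 ?(ltW f0)// lerXn2r// nnegrE ltW.
apply: le_trans (_ : expR (n%:R - 1) / n%:R <= _).
  rewrite ler_pM ?expR_ge0 ?invr_ge0 ?(ltW s0)//.
    by rewrite ler_expR; move: sn; rewrite -natr1; lra.
  by rewrite lef_pV2.
rewrite ler_pdivlMr// mulrAC ler_pdivrMr// mulrC -exprSr.
exact: fact_le_pow.
Qed.

Lemma expterm_exp_ge (B t delta : R) : 0 < delta -> 1 <= B * t ->
  delta * expR (- 2) * expR ((1 - delta) * (B * t)) <=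
  expterm (Num.trunc (B * t)) t * B ^+ Num.trunc (B * t).
Proof.
move=> d0 s1; set s := B * t; have s0 : 0 < s by rewrite (lt_le_trans ltr01).
have -> : expterm (Num.trunc s) t * B ^+ Num.trunc s = expterm (Num.trunc s) s.
  by rewrite /expterm /s exprMn mulrAC [t ^+ _ * _]mulrC.
apply: le_trans (expterm_ge s1); rewrite ler_pdivlMr//.
have ds : delta * s <= expR (delta * s).
  by apply: le_trans (expR_ge1Dx _); rewrite lerDr.
have -> : s - 2 = - 2 + ((1 - delta) * s + delta * s) by ring.
rewrite !expRD [delta * _]mulrC -!mulrA ler_wpM2l ?expR_ge0//.
rewrite mulrCA ler_wpM2l ?expR_ge0//.
Qed.

End FactorialBound.

(** * Lyapunov exponents *)

Section LyapunovLimit.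
Context {d : measure_display} {T : measurableType d} {R : realType}.
Variables (P : probability T R) (kappa h b : R).
Variables (eta : probability (measurableTypeR R) R).
Variables (xi : int -> {RV P >-> R}) (u : T -> R -> int -> R).
Hypotheses (kappa_gt0 : 0 < kappa) (h_gt0 : 0 < h) (h_le1 : h <= 1) (b_lt0 : b < 0).
Hypothesis eta_supp : eta `[b, 0]%classic = 1%E.
Hypothesis xi_iid : iid_with_law eta xi.
Hypothesis u_solution :
  \forall w \ae P, pam_solution kappa h (fun x => xi x w) (u w).

Local Notation c := (total_rate b (rright kappa h) (rleft kappa h)).
Local Notation moment := (moment b xi (rright kappa h) (rleft kappa h)).
Local Notation walk0 k w :=
  (walk b (rright kappa h) (rleft kappa h) k (xi^~ w) (fun=> 1) 0).

Lemma expectation_upper p B C q : 1 <= p -> 0 < B -> 0 <= C -> 0 <= q < 1 ->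
  (forall k, moment p k <= C * (q * B `^ p) ^+ k) ->
  forall t, 0 <= t ->
  ('E_P[fun w => (u w t 0 `^ p)%R] <=
    ((2 * expR ((B - c) * t)) `^ p * (C / (1 - q)))%:E)%E.
Proof.
move=> p1 B0 C0 q01 Hm t t0; rewrite unlock; set K := _ `^ p.
have Bp0 : 0 < B `^ p by exact: powR_gt0.
have K0 : 0 <= K by exact: powR_ge0.
pose z k w := walk0 k w `^ p / (B `^ p) ^+ k.
have z0 k w : 0 <= z k w by rewrite divr_ge0 ?powR_ge0// exprn_ge0// powR_ge0.
have bw k := bmeas_moment xi b_lt0 (rright_gt0 kappa_gt0 h_gt0)
  (rleft_ge0 kappa_gt0 h_le1) k p1.
have bz k : bmeas (z k).
  rewrite (_ : z k = fun w => ((B `^ p) ^+ k)^-1 * walk0 k w `^ p); first exact: bmeasZ.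
  by apply/funext => w; rewrite mulrC.
have mz k : measurable_fun setT (fun w => (z k w)%:E).
  by apply/measurable_EFinP; have [] := bz k.
have ms : measurable_fun setT (fun w => \sum_(k <oo) (z k w)%:E)%E.
  by apply: ge0_emeasurable_sum => // k w _ _; rewrite lee_fin.
apply: (@le_trans _ _ (\int[P]_w (K%:E * \sum_(k <oo) (z k w)%:E))%E).
  apply: ae_le_integral_upper.
  - by apply: measurable_funeM.
  - by move=> w; rewrite lee_fin powR_ge0.
  - by move=> w; rewrite mule_ge0 ?lee_fin// nneseries_ge0// => k _ _; rewrite lee_fin.
  apply: filterS (solution_ae eta_supp xi_iid u_solution) => w [xib sol].
  have [n Hn] := solution_upper kappa_gt0 h_gt0 h_le1 b_lt0 p1 t0 B0 xib sol.
  apply: (@le_trans _ _ (K%:E * (\sum_(0 <= k < n) (z k w)%:E))%E).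
    by rewrite sumEFin -EFinM lee_fin big_mkord.
  rewrite lee_wpmul2l ?lee_fin//; apply: nneseries_lim_ge => k _ _.
  by rewrite lee_fin.
rewrite ge0_integralZl_EFin//; last first.
  by move=> w _; rewrite nneseries_ge0// => k _ _; rewrite lee_fin.
rewrite EFinM lee_wpmul2l ?lee_fin//.
rewrite integral_nneseries//; last by move=> k w _; rewrite lee_fin.
apply: lime_le.
  by apply: is_cvg_nneseries => k _ _; apply: integral_ge0 => w _; rewrite lee_fin.
apply: nearW => n.
apply: (@le_trans _ _ (\sum_(0 <= k < n) (C * q ^+ k)%:E)%E).
  apply: lee_sum => k _; rewrite -mean_EFin// lee_fin.
  have -> : mean P (z k) = ((B `^ p) ^+ k)^-1 * moment p k.
    rewrite -meanZ//; congr mean; apply/funext => w; exact: mulrC.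
  by rewrite ler_pdivrMl ?exprn_gt0// mulrCA -exprMn [_ * q]mulrC.
rewrite sumEFin lee_fin -mulr_sumr ler_wpM2l// big_mkord.
exact: geometric_partial_le.
Qed.

Lemma expectation_bounds p rho : 1 <= p -> 0 < rho ->
  (forall n, moment p n <= (n + n).+1%:R `^ (p + 1) * (rho `^ p) ^+ n) ->
  (forall B, 0 < B < rho ->
    exists N, forall n, (N <= n)%N -> (B `^ p) ^+ n <= moment p n) ->
  forall B B', 0 < B < rho -> rho < B' ->
  exists K K' : R, [/\ 0 < K, 0 < K' & \forall t \near +oo_R,
    (((K * expR ((B - c) * t)) `^ p)%:E <= 'E_P[fun w => (u w t 0 `^ p)%R] <=
     ((K' * expR ((B' - c) * t)) `^ p)%:E)%E].
Proof.
move=> p1 rho0 up lo B B' /andP[B0 Brho] rhoB'.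
have p0 : 0 < p by rewrite (lt_le_trans _ p1).
have B'0 : 0 < B' by exact: lt_trans rhoB'.
have [C [q [C0 q01 HC]]] : exists C q : R, [/\ 0 < C, 0 <= q < 1 &
    forall k, moment p k <= C * (q * B' `^ p) ^+ k].
  pose y := (B' / rho) `^ p.
  have y1 : 1 < y.
    rewrite [ltLHS](_ : 1 = 1 `^ p); last by rewrite powR1.
    apply: gt0_ltr_powR => //; rewrite ?nnegrE//.
      by rewrite divr_ge0 ?ltW.
    by rewrite ltr_pdivlMr// mul1r.
  have y0 : 0 < y by exact: lt_trans y1.
  have p10 : 0 < p + 1 by lra.
  have y12 : 1 < (1 + y) / 2 by lra.
  have [C C0 HC] := poly_le_geometric p10 y12.
  exists C, ((1 + y) / 2 / y); split=> //.
    by rewrite divr_ge0 ?(ltW y0) ?ltr_pdivrMr// ?mul1r; lra.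
  move=> k; apply: le_trans (up k) _.
  have By : B' `^ p = y * rho `^ p.
    by rewrite /y -powRM ?divfK ?gt_eqF// ?divr_ge0 ?ltW.
  rewrite By mulrA divfK ?gt_eqF// exprMn mulrA ler_wpM2r//.
  by rewrite exprn_ge0// powR_ge0.
pose K := (1 - B / ((B + rho) / 2)) * expR (- 2) : R.
pose K' := 2 * (C / (1 - q)) `^ p^-1 : R.
have m0 : 0 < (B + rho) / 2 by lra.
have m1 : 0 < 1 - B / ((B + rho) / 2) by rewrite subr_gt0 ltr_pdivrMr//; lra.
have Cq0 : 0 < C / (1 - q) by rewrite divr_gt0//; lra.
exists K, K'; split; [by rewrite mulr_gt0 ?expR_gt0|by rewrite mulr_gt0 ?powR_gt0|].
have [|N HN] := lo ((B + rho) / 2); first by apply/andP; split=> //; lra.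
near=> t.
have t0 : 0 <= t by near: t; apply: nbhs_pinfty_ge; exact: num_real.
have tN : N.+1%:R / ((B + rho) / 2) <= t by near: t; apply: nbhs_pinfty_ge; exact: num_real.
apply/andP; split; last first.
  apply: le_trans (expectation_upper p1 B'0 (ltW C0) q01 HC t0) _.
  set E := expR _; have E0 : 0 <= E by exact: expR_ge0.
  rewrite (_ : (K' * E) `^ p = (2 * E) `^ p * (C / (1 - q)))//.
  rewrite /K'; move: (C / (1 - q)) Cq0 => D D0.
  rewrite mulrAC [LHS]powRM ?mulr_ge0 ?powR_ge0// -powRrM mulVf ?gt_eqF//.
  by rewrite powRr1// ltW.
set s := (B + rho) / 2 * t.
have sN : N.+1%:R <= s by rewrite /s mulrC -ler_pdivrMr.
have s1 : 1 <= s by rewrite (le_trans _ sN)// ler1n.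
have nN : (N <= Num.trunc s)%N.
  by rewrite -(ler_nat R); have /andP[_] := truncn_itv (le_trans ler01 s1);
    rewrite -natr1; move: sN; rewrite -natr1; lra.
apply: le_trans (expectation_lower kappa_gt0 h_gt0 h_le1 b_lt0 eta_supp xi_iid u_solution
  (Num.trunc s) p1 t0).
have e0 : 0 <= expR (- (c * t)) * expterm (Num.trunc s) t.
  by rewrite mulr_ge0 ?expR_ge0// divr_ge0// exprn_ge0.
rewrite lee_fin; apply: le_trans (ler_wpM2l (powR_ge0 _ _) (HN _ nN)).
rewrite -powR_exprn ?(ltW m0)// -powRM ?exprn_ge0 ?(ltW m0)//.
apply: ge0_ler_powR; rewrite ?nnegrE ?(ltW p0)//.
- by rewrite mulr_ge0 ?expR_ge0// mulr_ge0 ?expR_ge0// ltW.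
- by rewrite mulr_ge0// exprn_ge0// ltW.
have H := expterm_exp_ge m1 s1; rewrite subKr -/K in H.
rewrite -mulrA; apply: le_trans (ler_wpM2l (expR_ge0 (- (c * t))) H).
rewrite mulrCA -expRD ler_wpM2l//.
  by rewrite mulr_ge0 ?expR_ge0// ltW.
by rewrite ler_expR /s mulrA divfK ?gt_eqF//; lra.
Unshelve. all: by end_near. Qed.

End LyapunovLimit.

Section LyapunovValue.
Context {d : measure_display} {T : measurableType d} {R : realType}.
Variables (P : probability T R) (u : T -> R -> int -> R).

Lemma lyapunovE p rho c : 0 < p -> 0 < rho ->
  (forall B B', 0 < B < rho -> rho < B' ->
  exists K K' : R, [/\ 0 < K, 0 < K' & \forall t \near +oo_R,
    (((K * expR ((B - c) * t)) `^ p)%:E <= 'E_P[fun w => (u w t 0 `^ p)%R] <=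
     ((K' * expR ((B' - c) * t)) `^ p)%:E)%E]) ->
  lyapunov P u p = rho - c.
Proof.
move=> p0 rho0 H; apply: cvg_lim => //; apply/cvgrPdist_le => eps eps0.
pose del := Num.min (eps / 2) (rho / 2).
have del0 : 0 < del by rewrite lt_min !divr_gt0.
have de : del <= eps / 2 by rewrite ge_min lexx.
have dr : del <= rho / 2 by rewrite ge_min lexx orbT.
have Bi : 0 < rho - del < rho by apply/andP; split; lra.
have Bs : rho < rho + del by rewrite ltrDl.
have [K [K' [K0 K'0 HK]]] := H _ _ Bi Bs.
have e20 : 0 < eps / 2 by rewrite divr_gt0.
near=> t.
have t0 : 0 < t by near: t; apply: nbhs_pinfty_gt; exact: num_real.
have tK : `|ln K| / (eps / 2) <= t by near: t; apply: nbhs_pinfty_ge; exact: num_real.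
have tK' : `|ln K'| / (eps / 2) <= t by near: t; apply: nbhs_pinfty_ge; exact: num_real.
rewrite ler_pdivrMr// in tK; rewrite ler_pdivrMr// in tK'.
have : (((K * expR ((rho - del - c) * t)) `^ p)%:E <= 'E_P[fun w => (u w t 0 `^ p)%R] <=
     ((K' * expR ((rho + del - c) * t)) `^ p)%:E)%E by near: t.
move: ('E_P[fun w => (u w t 0 `^ p)%R])%E => X /andP[X1 X2].
have Xfin : X \is a fin_num.
  by rewrite fin_numElt (lt_le_trans _ X1) ?ltNyr// (le_lt_trans X2) ?ltry.
rewrite -(fineK Xfin) !lee_fin in X1 X2.
move: (fine X) X1 X2 => x {X Xfin} X1 X2.
set L := K * _ in X1; set L' := K' * _ in X2.
have L0 : 0 < L by rewrite mulr_gt0 ?expR_gt0.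
have L'0 : 0 < L' by rewrite mulr_gt0 ?expR_gt0.
have X0 : 0 < x := lt_le_trans (powR_gt0 p L0) X1.
have root y : 0 < y -> y = (y `^ p) `^ p^-1.
  by move=> y0; rewrite -powRrM mulfV ?gt_eqF// powRr1// ltW.
have nn (z : R) : 0 <= z -> z \in Num.nneg by [].
have ip0 : 0 <= p^-1 by rewrite invr_ge0 ltW.
have Y1 : L <= x `^ p^-1.
  rewrite {1}(root L L0).
  have := ge0_ler_powR ip0 (nn _ (powR_ge0 _ _)) (nn _ (ltW X0)) X1; exact.
have Y2 : x `^ p^-1 <= L'.
  rewrite (root L' L'0).
  exact: (ge0_ler_powR ip0 (nn _ (ltW X0)) (nn _ (powR_ge0 _ _)) X2).
have Y0 : 0 < x `^ p^-1 by rewrite powR_gt0.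
have Z1 : ln K + (rho - del - c) * t <= ln (x `^ p^-1).
  by rewrite -[X in _ + X]expRK -lnM ?posrE ?expR_gt0// ler_ln ?posrE.
have Z2 : ln (x `^ p^-1) <= ln K' + (rho + del - c) * t.
  by rewrite -[X in _ + X]expRK -lnM ?posrE ?expR_gt0// ler_ln ?posrE.
move: tK tK' => /ler_normlP[K1 _] /ler_normlP[_ K2].
have dt := ler_wpM2r (ltW t0) de.
move: (ln (x `^ _)) (ln K) (ln K') Z1 Z2 K1 K2 => y k k' Z1 Z2 K1 K2.
clear - Z1 Z2 K1 K2 dt t0.
rewrite ler_distlC; apply/andP; split.
  rewrite [leRHS]mulrC ler_pdivlMr//; lra.
by rewrite [leLHS]mulrC ler_pdivrMr//; lra.
Unshelve. all: by end_near. Qed.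

End LyapunovValue.

Section RateComparison.
Context {R : realType}.

Lemma rate_le (a D s x y : R) N : 0 < a -> 0 < D -> 0 < s -> 0 < x -> 0 < y ->
  (forall n, (N <= n)%N -> a * x ^+ n <= D * ((n + n).+1%:R `^ s * y ^+ n)) -> x <= y.
Proof.
move=> a0 D0 s0 x0 y0 H; rewrite leNgt; apply/negP => yx.
pose r := x / y; have r1 : 1 < r by rewrite ltr_pdivlMr// mul1r.
pose z := (1 + r) / 2; have z1 : 1 < z by rewrite /z; lra.
have zr : 1 < r / z by rewrite ltr_pdivlMr /z; lra.
have [C C0 HC] := poly_le_geometric s0 z1.
have [M HM] := expr_unbounded (D * C / a + 1) zr.
pose n := maxn N M.
have z0 : 0 < z by rewrite (lt_trans ltr01).
have H2 := HM n (leq_maxr _ _); have H1 := H n (leq_maxl _ _).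
have xn : x ^+ n = (r / z) ^+ n * (z ^+ n * y ^+ n).
  by rewrite -[z ^+ n * _]exprMn -exprMn mulrA divfK ?gt_eqF// /r divfK ?gt_eqF.
rewrite xn in H1.
have zy0 : 0 < z ^+ n * y ^+ n by rewrite mulr_gt0// exprn_gt0.
have : a * ((r / z) ^+ n * (z ^+ n * y ^+ n)) <= D * (C * (z ^+ n * y ^+ n)).
  apply: le_trans H1 _; rewrite ler_wpM2l ?(ltW D0)// mulrA.
  by rewrite ler_wpM2r ?exprn_ge0 ?(ltW y0)// HC.
rewrite mulrA [leRHS]mulrA ler_pM2r//; apply/negP; rewrite -ltNge.
apply: lt_le_trans (ler_wpM2l (ltW a0) H2).
by rewrite mulrDr mulrCA mulfV ?gt_eqF// !mulr1 ltrDl.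
Qed.

End RateComparison.

Section Nondegeneracy.
Context {d : measure_display} {T : measurableType d} {R : realType}.
Variables (P : probability T R) (b : R).
Variables (eta : probability (measurableTypeR R) R).
Variable xi : int -> {RV P >-> R}.
Hypotheses (b_lt0 : b < 0) (eta_supp : eta `[b, 0]%classic = 1%E).
Hypothesis xi_iid : iid_with_law eta xi.

Lemma site_mass_gt0 k : ess_sup P (fun w => (xi 0 w)%:E) = 0%E -> 0 < k ->
  0 < site_mass eta k.
Proof.
move=> sup0 k0.
have mk : measurable (`[- k, +oo[%classic : set R) by exact: measurable_itv.
rewrite lt_neqAle fine_ge0// andbT eq_sym; apply/negP => /eqP q0.
have ek : eta `[- k, +oo[%classic = 0%E.
  by rewrite -[LHS]fineK ?fin_num_measure//; congr EFin; exact: q0.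
have : (ess_sup P (fun w => (xi 0 w)%:E) <= (- k)%:E)%E.
  apply: ereal_inf_lbound => /=; exists (xi 0 @^-1` `[- k, +oo[%classic); split.
  - by rewrite -[X in measurable X]setTI; apply: measurable_funP.
  - exact: etrans (law_xi xi_iid 0 mk) ek.
  move=> w /= H; rewrite in_itv/= andbT leNgt; apply/negP => wk; apply: H.
  by rewrite lee_fin ltW.
by rewrite sup0 lee_fin leNgt oppr_lt0 k0.
Qed.

Lemma mean_weight_lt : ~ as_constant xi -> mean_weight b eta < - b.
Proof.
move=> nc; rewrite ltNge; apply/negP => mb; apply: nc; exists 0.
have bw := bmeas_weight b_lt0.
have z n : eta `]-oo, (b / n.+1%:R)[%classic = 0%E.
  set k := b / n.+1%:R.
  have k0 : k < 0 by rewrite ltr_pdivrMr// mul0r.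
  have bk : b <= k by rewrite ler_pdivlMr// ler_neMr ?ler1n// ltW.
  have mA : measurable (`]-oo, k[%classic : set R) by exact: measurable_itv.
  have bi : bmeas (\1_(`]-oo, k[%classic) : measurableTypeR R -> R) by exact: bmeas_indic.
  have : mean_weight b eta <= mean eta (fun y => - b + k * \1_(`]-oo, k[%classic) y).
    apply: le_mean => //.
      by apply: bmeasD; [exact: bmeas_cst|exact: bmeasZ].
    move=> y; have /andP[c1 c2] := clamp_itv b_lt0 y; rewrite indicE.
    have [yk|yk] := boolP (y \in _); last by rewrite mulr0; lra.
    have : clamp b y <= k.
      move: yk; rewrite inE /= in_itv/= => yk.
      by rewrite /clamp ge_max bk ge_min (ltW yk).
    by rewrite mulr1; lra.
  rewrite meanD ?mean_cst ?meanZ//; last exact: bmeasZ; last exact: bmeas_cst.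
  rewrite mean_indic// => H.
  have : 0 <= k * fine (eta `]-oo, k[%classic) by lra.
  rewrite nmulr_rge0// => e0.
  rewrite -[LHS]fineK ?fin_num_measure//; congr EFin; apply/eqP.
  by rewrite eq_le fine_ge0 ?andbT.
apply: ae_int => x.
have H : \forall w \ae P, forall n, b / n.+1%:R <= xi x w.
  apply: ae_foralln => n; exists (xi x @^-1` `]-oo, (b / n.+1%:R)[%classic); split.
  - rewrite -[X in measurable X]setTI; apply: measurable_funP => //.
  - by apply: etrans (law_xi xi_iid x _) (z n); exact: measurable_itv.
  - by move=> w /= H; rewrite in_itv/= ltNge; apply/negP.
apply: filterS2 H (xi_supp eta_supp xi_iid x) => w Hn /andP[_ x0].
apply/eqP; rewrite eq_le x0 leNgt; apply/negP => x0'.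
pose n := Num.trunc (b / xi x w); have := Hn n.
apply/negP; rewrite -ltNge ltr_pdivlMr//.
rewrite mulrC -ltr_ndivrMr//; exact: truncnS_gt.
Qed.

End Nondegeneracy.

Section Intermittency.
Context {d : measure_display} {T : measurableType d} {R : realType}.
Variables (P : probability T R) (b rr ll : R) (xi : int -> {RV P >-> R}).
Hypotheses (b_lt0 : b < 0) (rr_gt0 : 0 < rr) (ll_ge0 : 0 <= ll).

Local Notation moment := (moment b xi rr ll).

Lemma moment_interpolation p e K n : 1 <= p -> 0 < e -> 0 < K ->
  moment p n / (K ^+ n) `^ p <=
  moment 1 n / K ^+ n + moment (p + e) n / (K ^+ n) `^ (p + e).
Proof.
move=> p1 e0 K0; have Kn0 : 0 < K ^+ n by rewrite exprn_gt0.
have p0 : 0 < p by rewrite (lt_le_trans _ p1).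
have pe1 : 1 <= p + e by rewrite (le_trans p1)// lerDl ltW.
have b1 := bmeas_moment xi b_lt0 rr_gt0 ll_ge0 n (lexx 1).
have bp := bmeas_moment xi b_lt0 rr_gt0 ll_ge0 n p1.
have be := bmeas_moment xi b_lt0 rr_gt0 ll_ge0 n pe1.
rewrite ![_ / _]mulrC -!meanZ// -meanD; [|exact: bmeasZ|exact: bmeasZ].
apply: le_mean => [||w]; [exact: bmeasZ|by apply: bmeasD; exact: bmeasZ|].
set a := walk _ _ _ _ _ _ _; have a0 : 0 <= a by exact: walk_ge0.
rewrite powRr1// -!powR_inv1 ?powR_ge0 ?(ltW Kn0)//.
rewrite ![(_ `^ _) `^ (-1)]powRAC -!powRM ?powR_ge0//.
rewrite powR_inv1 ?(ltW Kn0)//; set x := (K ^+ n)^-1 * a.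
have : 0 <= x by rewrite mulr_ge0// invr_ge0 ltW.
rewrite le_eqVlt => /predU1P[<-|x0].
  by rewrite powR0 ?gt_eqF// add0r powR_ge0.
have [x1|/ltW x1] := leP x 1.
  apply: le_trans (_ : x <= _); last by rewrite lerDl powR_ge0.
  by apply: ge1r_powR => //; rewrite x0.
apply: le_trans (_ : x `^ (p + e) <= _); last by rewrite lerDr ltW.
by apply: ler_powR => //; rewrite lerDl ltW.
Qed.

(* If [rho'] were at most [rho], then [moment_interpolation] at a level
   slightly above [rho] would bound [moment p] by a smaller rate. *)
Lemma growth_rate_lt p e rho rho' theta C : 1 <= p -> 0 < e ->
  0 < theta < rho -> 0 < rho' ->
  (forall n, moment 1 n <= C * theta ^+ n) ->
  (forall B, 0 < B < rho ->
    exists N, forall n, (N <= n)%N -> (B `^ p) ^+ n <= moment p n) ->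
  (forall n, moment (p + e) n <= (n + n).+1%:R `^ (p + e + 1) * (rho' `^ (p + e)) ^+ n) ->
  rho < rho'.
Proof.
move=> p1 e0 /andP[th0 thr] r'0 H1 lo up; rewrite ltNge; apply/negP => r'r.
have p0 : 0 < p by rewrite (lt_le_trans _ p1).
have r0 : 0 < rho by exact: lt_trans thr.
pose om := theta / rho; have om0 : 0 < om by rewrite divr_gt0.
have om1 : om < 1 by rewrite ltr_pdivrMr// mul1r.
pose sg := om `^ p^-1; have sg0 : 0 < sg by rewrite powR_gt0.
have sgp : sg `^ p = om by rewrite -powRrM mulVf ?gt_eqF// powRr1// ltW.
have pow_lt1 x y : 0 < x -> 0 < y < 1 -> y `^ x < 1 :> R.
  move=> x0 /andP[y0 y1]; rewrite [ltRHS](_ : 1 = 1 `^ x); last by rewrite powR1.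
  by apply: gt0_ltr_powR => //; rewrite nnegrE ltW.
have sg1 : sg < 1 by apply: pow_lt1; rewrite ?invr_gt0 ?om0.
pose K := rho / sg; have K0 : 0 < K by rewrite divr_gt0.
pose m := Num.max (om * sg) (sg `^ (p + e)).
have m0 : 0 < m by rewrite lt_max mulr_gt0.
have mom : m < om.
  rewrite gt_max gtr_pMr// sg1 /= powRD ?(gt_eqF sg0) ?implybT// sgp gtr_pMr//.
  by apply: pow_lt1 => //; rewrite sg0.
pose mid := (m + om) / 2.
have mid0 : 0 < mid by rewrite /mid; lra.
pose B := K * mid `^ p^-1.
have B0 : 0 < B by rewrite mulr_gt0// powR_gt0.
have Br : B < rho.
  rewrite /B /K mulrAC ltr_pdivrMr// ltr_pM2l//.
  apply: gt0_ltr_powR; rewrite ?invr_gt0 ?nnegrE ?(ltW mid0) ?(ltW om0)//.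
  by rewrite /mid; lra.
have [N HN] := lo B (ltac:(by rewrite B0)).
have C0 : 0 <= C.
  have := H1 0%N; rewrite expr0 mulr1; apply: le_trans.
  by apply: mean_ge0 => w; exact: powR_ge0.
have pe1 : 0 < p + e + 1 by lra.
have w1 n : 1 <= (n + n).+1%:R `^ (p + e + 1) :> R.
  by rewrite -[leLHS](powRr0 (n + n).+1%:R); apply: ler_powR; [rewrite ler1n|lra].
have : mid <= m.
  apply: (@rate_le _ 1 (C + 1) (p + e + 1) mid m N) => // [|n Nn]; first by rewrite ltr_wpDl.
  rewrite mul1r; have Kn0 : 0 < K ^+ n by exact: exprn_gt0.
  have midn : mid ^+ n = (B `^ p) ^+ n / (K ^+ n) `^ p.
    rewrite powR_exprn ?(ltW K0)// /B powRM ?(ltW K0) ?powR_ge0//.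
    rewrite -powRrM mulVf ?gt_eqF// powRr1 ?(ltW mid0)//.
    by rewrite [(_ * mid) ^+ n]exprMn mulrAC mulfV ?mul1r// gt_eqF// exprn_gt0// powR_gt0.
  rewrite midn; apply: le_trans (_ : moment p n / (K ^+ n) `^ p <= _).
    by rewrite ler_wpM2r ?invr_ge0 ?powR_ge0// HN.
  apply: le_trans (moment_interpolation n p1 e0 K0) _.
  have mK0 : 0 < m * K by exact: mulr_gt0.
  have mn0 : 0 <= m ^+ n by rewrite exprn_ge0// ltW.
  rewrite mulrDl mul1r; apply: lerD.
    apply: le_trans (_ : C * m ^+ n <= _); last first.
      by rewrite ler_wpM2l// ler_peMl.
    rewrite ler_pdivrMr// -mulrA -exprMn; apply: le_trans (H1 n) _.
    rewrite ler_wpM2l// lerXn2r ?nnegrE ?(ltW th0) ?(ltW mK0)//.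
    apply: le_trans (_ : om * sg * K <= _); last by rewrite ler_wpM2r ?(ltW K0)// le_max lexx.
    by rewrite /K -[om * sg * _]mulrA [sg * _]mulrC divfK ?gt_eqF// /om divfK ?gt_eqF.
  rewrite ler_pdivrMr ?powR_gt0//; apply: le_trans (up n) _.
  rewrite -mulrA ler_wpM2l ?powR_ge0// powR_exprn ?(ltW K0)// -exprMn.
  rewrite lerXn2r ?nnegrE ?mulr_ge0 ?powR_ge0 ?(ltW m0)//.
  apply: le_trans (_ : rho `^ (p + e) <= _).
    by apply: ge0_ler_powR; rewrite ?nnegrE ?(ltW r'0) ?(ltW r0)//; lra.
  apply: le_trans (_ : sg `^ (p + e) * K `^ (p + e) <= _).
    by rewrite -powRM ?(ltW sg0) ?(ltW K0)// /K mulrC divfK ?gt_eqF.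
  by rewrite ler_wpM2r ?powR_ge0// le_max lexx orbT.
by rewrite /mid; lra.
Qed.

End Intermittency.

Lemma growth_rate_gt (d : measure_display) (T : measurableType d) (R : realType)
    (P : probability T R) (b : R) (eta : probability (measurableTypeR R) R)
    (xi : int -> {RV P >-> R}) (rr ll theta : R) :
  b < 0 -> eta `[b, 0]%classic = 1%E -> iid_with_law eta xi -> 0 < rr -> 0 <= ll ->
  (forall k, 0 < k -> 0 < site_mass eta k) -> 0 < theta < total_rate b rr ll ->
  \forall p \near +oo_R, 1 <= p /\ forall rho, 0 < rho ->
    (forall n, moment b xi rr ll p n <= (n + n).+1%:R `^ (p + 1) * (rho `^ p) ^+ n) ->
    theta < rho.
Proof.
move=> b0 eta_supp xi_iid rr0 ll0 mass /andP[th0 thc]; set c := total_rate b rr ll in thc.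
pose k := Num.min ((c - theta) / 2) (- b).
have k0 : 0 < k by rewrite lt_min oppr_gt0 b0 andbT divr_gt0// subr_gt0.
have kc : k <= (c - theta) / 2 by rewrite ge_min lexx.
have kb : 0 <= k <= - b by rewrite (ltW k0) ge_min lexx orbT.
have q0 := mass k k0; set q := site_mass eta k in q0.
pose y := (c - k) / theta.
have ck0 : 0 < c - k by lra.
have y1 : 1 < y by rewrite /y ltr_pdivlMr// mul1r; lra.
have lny : 0 < ln y by exact: ln_gt0.
near=> p.
have p1 : 1 <= p by near: p; apply: nbhs_pinfty_ge; exact: num_real.
have p0 : 0 < p by rewrite (lt_le_trans _ p1).
have pq : - (2 * ln q) / ln y < p by near: p; apply: nbhs_pinfty_gt; exact: num_real.
split=> // rho rho0 up; rewrite ltNge; apply/negP => rth.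
have x0 : 0 < q ^+ 2 * (c - k) `^ p by rewrite mulr_gt0 ?exprn_gt0 ?powR_gt0.
have xr : q ^+ 2 * (c - k) `^ p <= rho `^ p.
  apply: (@rate_le _ q 1 (p + 1) _ _ 0%N) => //; [lra|exact: powR_gt0|move=> n _].
  rewrite mul1r; apply: le_trans (up n).
  apply: le_trans (moment_ge b0 xi_iid rr0 ll0 n p1 kb); rewrite -/c -/q.
  rewrite [(q ^+ 2 * _) ^+ n]exprMn mulrA -exprM -exprS.
  by rewrite (_ : (2 * n).+1 = (n + n).+1)// mul2n addnn.
have : q ^+ 2 * (c - k) `^ p <= theta `^ p.
  by apply: le_trans xr _; apply: ge0_ler_powR; rewrite ?nnegrE ?(ltW p0) ?(ltW rho0) ?(ltW th0).
have -> : (c - k) `^ p = y `^ p * theta `^ p.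
  by rewrite -powRM ?(ltW th0) ?(le_trans ler01 (ltW y1))// /y divfK ?gt_eqF.
rewrite mulrA ger_pMl ?powR_gt0//; apply/negP; rewrite -ltNge.
have yp0 : 0 < y `^ p by rewrite powR_gt0// (lt_trans ltr01).
rewrite -ltr_ln ?posrE ?mulr_gt0 ?exprn_gt0// ln1 lnM ?posrE ?exprn_gt0//.
rewrite lnXn// ln_powR -mulr_natl; move: pq; rewrite ltr_pdivrMr//; lra.
Unshelve. all: by end_near. Qed.

Theorem proposition2p8 (R : realType) (d : measure_display)
    (T : measurableType d) (P : probability T R)
    (kappa h b : R) (eta : probability (measurableTypeR R) R)
    (xi : int -> {RV P >-> R}) (u : T -> R -> int -> R)
    (kappa_gt0 : 0 < kappa) (h_gt0 : 0 < h) (h_le1 : h <= 1) (b_lt0 : b < 0)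
    (eta_supp : eta `[b, 0]%classic = 1%E)
    (xi_iid : iid_with_law eta xi)
    (xi_nonconstant : ~ as_constant xi)
    (xi_esssup : ess_sup P (fun w => (xi 0 w)%:E) = 0%E)
    (u_solution : \forall w \ae P, pam_solution kappa h (fun x => xi x w) (u w)) :
  \forall p \near +oo_R, intermittent P u p.
Proof.
have rr0 := rright_gt0 kappa_gt0 h_gt0.
have ll0 := rleft_ge0 kappa_gt0 h_le1.
have llrr : rleft kappa h < rright kappa h.
  by rewrite ltr_pM2r ?invr_gt0// ltr_pM2l//; lra.
have mw := mean_weight_lt b_lt0 eta_supp xi_iid xi_nonconstant.
have [C [theta [thc decay]]] := annealed_decay b_lt0 ll0 llrr mw.
pose M := moment b xi (rright kappa h) (rleft kappa h).
have M1 n : M 1 n <= C * theta ^+ n.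
  apply: le_trans (decay n (fun=> 0)); rewrite -(@annealedE _ _ _ P b eta xi)//; last first.
    by apply: observable_walk.
  rewrite /M /moment /annealed le_eqVlt; apply/orP; left; apply/eqP; congr mean.
  by apply/funext => w; rewrite powRr1//; exact: walk_ge0.
have mass k : 0 < k -> 0 < site_mass eta k by exact: (site_mass_gt0 xi_iid xi_esssup).
have rate p : 1 <= p -> exists rho, [/\ 0 < rho,
    forall n, M p n <= (n + n).+1%:R `^ (p + 1) * (rho `^ p) ^+ n,
    (forall B, 0 < B < rho ->
      exists N, forall n, (N <= n)%N -> (B `^ p) ^+ n <= M p n) &
    lyapunov P u p = rho - total_rate b (rright kappa h) (rleft kappa h)].
  move=> p1; have [rho [rho0 up lo]] := moment_rate b_lt0 eta_supp xi_iid rr0 ll0 p1.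
  exists rho; split=> //; apply: lyapunovE => //; first exact: lt_le_trans p1.
  move=> B B'; exact: (expectation_bounds kappa_gt0 h_gt0 h_le1 b_lt0 eta_supp xi_iid
    u_solution p1 rho0 up lo).
apply: filterS (growth_rate_gt b_lt0 eta_supp xi_iid rr0 ll0 mass thc) => p [p1 thr].
have [rho [rho0 up lo lyap]] := rate p p1; rewrite /intermittent lyap.
have {}thr := thr rho rho0 up.
near=> e.
have e0 : 0 < e by near: e; exact: nbhs_right_gt.
have pe1 : 1 <= p + e by rewrite (le_trans p1)// lerDl ltW.
have [rho' [rho'0 up' _ ->]] := rate _ pe1.
rewrite ltrD2r; have /andP[th0 _] := thc.
apply: (growth_rate_lt b_lt0 rr0 ll0 p1 e0 _ rho'0 M1 lo up').
by rewrite th0.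
Unshelve. all: by end_near. Qed.
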